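(* Let $c \in [1/2,1)$. Then $c$ is the threshold for diameter 2 for the family of groups $((C_2)^n \times C_{m_n})_n$, where $C_m$ denotes the cyclic group of order $m$ and $m_n = \lfloor 2^{\frac{(1-c)n}{c}} \rfloor$.
   Context: For a finite group $G$ and a subset $S \subseteq G$, the Cayley graph $\Gamma(G;S)$ has vertex set $G$ and an edge between distinct $g,h$ if and only if $hg^{-1} \in S$ or $gh^{-1} \in S$ (loops and multiple edges are ignored). The random model $\mathcal{G}(G,p)$ is the probability space of graphs $\Gamma(G;S)$ where each element of $G$ is put in $S$ independently with probability $p$. The diameter of a disconnected graph is taken to be infinite. Let $(G_k)$ be a family of finite groups of orders $n_k$ with $n_k \to \infty$. A real $c>0$ is the threshold for diameter 2 for $(G_k)$ if for every $\varepsilon>0$, with probability tending to $1$ as $k\to\infty$, $\Gamma \in \mathcal{G}(G_k,p)$ has diameter greater than 2 if $p \leqslant \sqrt{(c-\varepsilon)\frac{\log n_k}{n_k}}$ and has diameter at most 2 if $p \geqslant \sqrt{(c+\varepsilon)\frac{\log n_k}{n_k}}$. *)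

(* Defs.v *)
From HB Require Import structures.
From mathcomp Require Import all_boot all_order all_fingroup all_solvable all_algebra.
From mathcomp Require Import all_classical all_reals all_analysis.

Set Implicit Arguments.
Unset Strict Implicit.
Unset Printing Implicit Defensive.

Import Order.TTheory GRing.Theory Num.Theory.
Import numFieldNormedType.Exports.

Local Open Scope classical_set_scope.
Local Open Scope ring_scope.

(* The infimum of the empty set is +oo, so vertices in distinct components are
   at distance +oo. *)
Definition graph_dist (R : realType) (T : finType) (e : rel T) (x y : T) :
    \bar R :=
  ereal_inf [set ((size s)%:R)%:E | s in [set s : seq T | path e x s /\ last x s = y]].

Definition diameter (R : realType) (T : finType) (e : rel T) : \bar R :=
  ereal_sup [set graph_dist R e xy.1 xy.2 | xy in [set: T * T]].

Definition cayley_graph (gT : finGroupType) (S : {set gT}) : rel gT :=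
  fun g h => (g != h) && ((h * g^-1 \in S)%g || (g * h^-1 \in S)%g).

(* The probability, in the random Cayley graph model of parameter p, of the
   graph property E: S is drawn from the product over gT of the Bernoulli(p)
   laws. *)
Definition cayley_prob (R : realType) (gT : finGroupType) (p : R)
    (E : pred (rel gT)) : R :=
  \sum_(S : {set gT} | E (cayley_graph S))
    \prod_(g : gT) (if g \in S then p else 1 - p).

(* p is a function of k, and the bounds on it are only required for all large
   k: for small k the upper bound may exceed 1, while p k is a probability for
   every k. Num.sqrt is 0 at negative arguments, so that for eps >= c the first
   clause only concerns p k = 0. *)
Definition diameter2_threshold (R : realType) (G : nat -> finGroupType)
    (c : R) : Prop :=
  0 < c /\
  forall eps : R, 0 < eps ->
  forall p : nat -> R, (forall k, 0 <= p k <= 1) ->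
    ((\forall k \near \oo,
        p k <= Num.sqrt ((c - eps) * (ln (#|G k|%:R) / #|G k|%:R))) ->
      cayley_prob (p k) (fun e : rel (G k) => (2%:E < diameter R e)%E)
        @[k --> \oo] --> (1 : R))
    /\
    ((\forall k \near \oo,
        Num.sqrt ((c + eps) * (ln (#|G k|%:R) / #|G k|%:R)) <= p k) ->
      cayley_prob (p k) (fun e : rel (G k) => (diameter R e <= 2%:E)%E)
        @[k --> \oo] --> (1 : R)).

(* The additive group of integers mod m, for m > 0; unlike 'Z_m, it has order 1
   when m = 1. *)
Definition cyclic_group (m : nat) : finGroupType := 'I_m.-1.+1.

Definition group_power (gT : finGroupType) (n : nat) : finGroupType :=
  {dffun forall i : 'I_n, gT}.

(* truncn is the floor, as a natural number, of a nonnegative real. *)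
Definition cyclic_factor_order (R : realType) (c : R) (n : nat) : nat :=
  Num.truncn (2 `^ ((1 - c) * n%:R / c)).

Definition C2n_Cm (R : realType) (c : R) (n : nat) : finGroupType :=
  (group_power (cyclic_group 2) n *
   cyclic_group (cyclic_factor_order c n))%type.

(* Main.v *)
(* For x != 1, the vertices g and x g are at distance more than 2 only if S spans
   no edge {s, t} with t in {x^+-1 s^+-1}, i.e. only if S is independent in a graph
   [translates x] of degree at most 4. For a random S, a graph of degree at most D
   with E edges satisfies
     (1 - p^2)^E <= P(S independent) <= (1 - p^2 + 2 D p^3)^E
   by Harris and Janson, so up to a factor 1 + o(1) only the number of edges matters
   when N p^3 -> 0, where N = #|G|. It is about N for the at most 2 * 2^n
   involutions x, and about 2 N for all other x, because t^2 = y has at most 2 * 2^n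
   solutions. As 2^n is N^c up to a factor 2 and 2 c >= 1, the union bound gives the
   upper bound on the threshold. For the lower bound, the second moment method
   applies to the elements of C_2^n: the edge sets of two of them are disjoint, so
   that the corresponding events are asymptotically uncorrelated. *)

Require Import Defs.
From HB Require Import structures.
From mathcomp Require Import all_boot all_order all_fingroup all_solvable all_algebra.
From mathcomp Require Import all_classical all_reals all_analysis.
From mathcomp Require Import ring lra zify.

Set Implicit Arguments.
Unset Strict Implicit.
Unset Printing Implicit Defensive.

Import Order.TTheory GRing.Theory Num.Theory.
Local Open Scope ring_scope.

(** * Means over random subsets with independent membership *)

Section RandomSubset.
Context {R : realFieldType} {I : finType}.
Implicit Types (w : I -> R) (f : {set I} -> R) (S : {set I}).

(** The weight may depend on the element, so that [bernoulli_mean_anti] can change one weight at a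
    time. *)
Definition bernoulli_mean w f : R :=
  \sum_(S : {set I}) (\prod_i (if i \in S then w i else 1 - w i)) * f S.

(** Localized at one element because, for a decreasing [f >= 0], a product such as
    [(b \in S)%:R * f S] is in general decreasing only away from [b]. *)
Definition decreasing_at u f := forall S, u \notin S -> f (u |: S)%SET <= f S.

Definition decreasing f := forall u, decreasing_at u f.

Lemma eq_bernoulli_mean w f g : f =1 g -> bernoulli_mean w f = bernoulli_mean w g.
Proof. by move=> fg; apply: eq_bigr => S _; rewrite fg. Qed.

(** Conditioning on everything but [u]: the sets containing [u] are paired with those avoiding it by
    [S |-> u |: S]. *)
Lemma bernoulli_mean_split w f u :
  bernoulli_mean w f = \sum_(S : {set I} | u \notin S)
    (\prod_(i | i != u) (if i \in S then w i else 1 - w i)) *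
    (w u * f (u |: S)%SET + (1 - w u) * f S).
Proof.
rewrite /bernoulli_mean (bigID (fun S : {set I} => u \in S)) /= addrC.
rewrite [X in _ + X](reindex_onto (fun S => u |: S)%SET (fun S => S :\ u)%SET) /=;
  last by move=> S uS; rewrite finset.setD1K.
rewrite [X in _ + X](eq_bigl (fun S : {set I} => u \notin S)); last first.
  move=> S; rewrite finset.setU11 /=; apply/eqP/idP => [<-|uS].
    by rewrite finset.in_setD1 eqxx.
  by rewrite finset.setU1K.
rewrite -big_split /=; apply: eq_bigr => S uS.
rewrite (bigD1 u) //= (negbTE uS) [X in _ + X * _](bigD1 u) //= finset.setU11.
rewrite [X in _ + _ * X * _](eq_bigr (fun i => if i \in S then w i else 1 - w i)).
  by ring.
by move=> i iu; rewrite finset.in_setU1 (negbTE iu).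
Qed.

(** Expanding the product of the factors [w i + (1 - w i)] gives one term per subset. *)
Lemma bernoulli_mean1 w : bernoulli_mean w (fun=> 1) = 1.
Proof.
transitivity (\prod_i \sum_(b : bool) (if b then w i else 1 - w i)); last first.
  by rewrite big1 // => i _; rewrite big_bool /=; ring.
rewrite bigA_distr_bigA /= /bernoulli_mean.
rewrite (reindex_onto (fun g : {ffun I -> bool} => [set i | g i])%SET
   (fun S => [ffun i => i \in S])) /=; last first.
  by move=> S _; apply/setP => i; rewrite inE ffunE.
apply: eq_big => g; last by move=> _; rewrite mulr1; apply: eq_bigr => i _; rewrite inE.
by apply/eqP; apply/ffunP => i; rewrite ffunE inE.
Qed.

Lemma bernoulli_meanD w f g :
  bernoulli_mean w (fun S => f S + g S) = bernoulli_mean w f + bernoulli_mean w g.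
Proof. by rewrite -big_split; apply: eq_bigr => S _; rewrite mulrDr. Qed.

Lemma bernoulli_meanZ w a f :
  bernoulli_mean w (fun S => a * f S) = a * bernoulli_mean w f.
Proof. by rewrite mulr_sumr; apply: eq_bigr => S _; rewrite mulrCA. Qed.

Lemma bernoulli_meanB w f g :
  bernoulli_mean w (fun S => f S - g S) = bernoulli_mean w f - bernoulli_mean w g.
Proof.
by rewrite -mulN1r -bernoulli_meanZ -bernoulli_meanD; apply: eq_bernoulli_mean => S; ring.
Qed.

Lemma bernoulli_mean_sum (J : Type) (r : seq J) (P : pred J) w
    (F : J -> {set I} -> R) :
  bernoulli_mean w (fun S => \sum_(j <- r | P j) F j S) =
  \sum_(j <- r | P j) bernoulli_mean w (F j).
Proof.
rewrite exchange_big /=; apply: eq_bigr => S _.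
by rewrite mulr_sumr.
Qed.

Section Weights.
Variable w : I -> R.
Hypothesis w01 : forall i, 0 <= w i <= 1.

Lemma weight_ge0 (P : pred I) S :
  0 <= \prod_(i | P i) (if i \in S then w i else 1 - w i).
Proof.
apply: prodr_ge0 => i _; have /andP[w0 w1] := w01 i.
by case: ifP => // _; rewrite subr_ge0.
Qed.

Lemma ler_bernoulli_mean f g :
  (forall S, f S <= g S) -> bernoulli_mean w f <= bernoulli_mean w g.
Proof.
by move=> fg; apply: ler_sum => S _; apply: ler_wpM2l (fg S); exact: weight_ge0.
Qed.

Lemma bernoulli_mean_ge0 f : (forall S, 0 <= f S) -> 0 <= bernoulli_mean w f.
Proof. by move=> f0; apply: sumr_ge0 => S _; rewrite mulr_ge0 ?weight_ge0. Qed.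

(** One-point Harris inequality: once the rest of [S] is fixed, [f] at [u |: S] is at most its
    average over the two states of [u]. *)
Lemma bernoulli_mean_mem_le u f : decreasing_at u f ->
  bernoulli_mean w (fun S => (u \in S)%:R * f S) <= w u * bernoulli_mean w f.
Proof.
move=> df; rewrite !(bernoulli_mean_split _ _ u) mulr_sumr.
apply: ler_sum => S uS; rewrite finset.setU11 (negbTE uS) mul1r mul0r mulr0 addr0.
have /andP[w0 w1] := w01 u; rewrite mulrCA; apply: ler_wpM2l => //.
apply: ler_wpM2l; first exact: weight_ge0.
have := df _ uS; nra.
Qed.

Lemma bernoulli_mean_notin_ge u f : decreasing_at u f ->
  (1 - w u) * bernoulli_mean w f <= bernoulli_mean w (fun S => (u \notin S)%:R * f S).
Proof.
move=> df; rewrite [leRHS](@eq_bernoulli_mean _ _ (fun S => f S - (u \in S)%:R * f S)).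
  by rewrite bernoulli_meanB mulrBl mul1r lerB // bernoulli_mean_mem_le.
by move=> S; case: (u \in S); rewrite ?mul1r ?mul0r ?subrr ?subr0.
Qed.

Lemma bernoulli_mean_mem u f : (forall S, u \notin S -> f (u |: S)%SET = f S) ->
  bernoulli_mean w (fun S => (u \in S)%:R * f S) = w u * bernoulli_mean w f.
Proof.
move=> df; rewrite !(bernoulli_mean_split _ _ u) mulr_sumr.
apply: eq_bigr => S uS; rewrite finset.setU11 (negbTE uS) df // mul1r mul0r.
by ring.
Qed.

End Weights.

(** The weights are raised one element at a time, through the hybrids [h r] that use [w'] on [r] and
    [w] elsewhere; by [bernoulli_mean_split] each raise moves mass from [f S] to the smaller
    [f (u |: S)]. *)
Lemma bernoulli_mean_anti w w' f : (forall i, 0 <= w i <= 1) ->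
  (forall i, 0 <= w' i <= 1) -> (forall i, w i <= w' i) -> decreasing f ->
  bernoulli_mean w' f <= bernoulli_mean w f.
Proof.
move=> w01 w'01 ww' df.
pose h (r : seq I) i := if i \in r then w' i else w i.
have h01 r i : 0 <= h r i <= 1 by rewrite /h; case: ifP.
have hP r : bernoulli_mean (h r) f <= bernoulli_mean w f.
  elim: r => [|u r IH]; first by [].
  apply: le_trans IH; rewrite !(bernoulli_mean_split _ _ u).
  apply: ler_sum => S uS.
  rewrite (eq_bigr (fun i => if i \in S then h r i else 1 - h r i)); last first.
    by move=> i iu; rewrite /h inE (negbTE iu).
  apply: ler_wpM2l; first exact: weight_ge0.
  have hu : h r u <= h (u :: r) u by rewrite /h inE eqxx /=; case: ifP.
  have := df _ _ uS; nra.
have <- : bernoulli_mean (h (enum I)) f = bernoulli_mean w' f; last exact: hP.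
by apply: eq_bigr => S _; congr (_ * _); apply: eq_bigr => i _; rewrite /h mem_enum.
Qed.

End RandomSubset.

(** * Harris and Janson bounds for independence of a random set *)

Section IndependentSets.
Context {R : realFieldType} {I : finType}.
Implicit Types (f : {set I} -> R) (S e : {set I}) (es : seq {set I}).

Definition independent es S := all (fun e => ~~ (e \subset S)) es.

Lemma independentS es S S' :
  S \subset S' -> independent es S' -> independent es S.
Proof.
move=> SS' /allP iS; apply/allP => e /iS; apply: contra => eS.
exact: fintype.subset_trans eS SS'.
Qed.

Lemma independent_decreasing es :
  decreasing (fun S => (independent es S)%:R : R).
Proof.
move=> u S _; rewrite ler_nat.
case: (boolP (independent es (u |: S)%SET)) => // h.
by rewrite (independentS (finset.subsetU1 u S) h).
Qed.

Variable p : R.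
Hypothesis p01 : 0 <= p <= 1.
Local Notation E := (@bernoulli_mean R I (fun=> p)).
Let w01 (i : I) : 0 <= p <= 1 := p01.

Lemma subset2E (a b : I) S : ([set a; b]%SET \subset S) = (a \in S) && (b \in S).
Proof. by rewrite finset.subUset !finset.sub1set. Qed.

(** The one-point inequality is applied once for each end of [e]; the indicator of [b \in S] does
    not disturb monotonicity at [a], since [a] and [b] differ. *)
Lemma bernoulli_mean_edge_le e f : #|e| = 2%N -> (forall S, 0 <= f S) ->
  decreasing f -> E (fun S => (e \subset S)%:R * f S) <= p ^+ 2 * E f.
Proof.
move=> /eqP/cards2P[a [b [ab ->]]] f0 df.
have /andP[p0 _] := p01.
rewrite (@eq_bernoulli_mean _ _ _ _ (fun S => (a \in S)%:R * ((b \in S)%:R * f S))); last first.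
  by move=> S; rewrite subset2E mulrA -natrM mulnb.
rewrite expr2 -mulrA; apply: le_trans (bernoulli_mean_mem_le w01 _) _.
  move=> S aS; rewrite finset.in_setU1 eq_sym (negbTE ab) /=.
  by apply: ler_wpM2l => //; apply: df.
by apply: ler_wpM2l => //; apply: bernoulli_mean_mem_le.
Qed.

Lemma bernoulli_mean_edge e f : #|e| = 2%N ->
  (forall u S, u \in e -> u \notin S -> f (u |: S)%SET = f S) ->
  E (fun S => (e \subset S)%:R * f S) = p ^+ 2 * E f.
Proof.
move=> /eqP/cards2P[a [b [ab ->]]] df.
rewrite (@eq_bernoulli_mean _ _ _ _ (fun S => (a \in S)%:R * ((b \in S)%:R * f S))); last first.
  by move=> S; rewrite subset2E mulrA -natrM mulnb.
rewrite expr2 -mulrA bernoulli_mean_mem; last first.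
  move=> S aS; rewrite finset.in_setU1 eq_sym (negbTE ab) /=.
  by rewrite df // !inE eqxx.
by rewrite bernoulli_mean_mem // => S bS; rewrite df // !inE eqxx orbT.
Qed.

Lemma independent_cons e es S :
  (independent (e :: es) S)%:R =
  (independent es S)%:R - (e \subset S)%:R * (independent es S)%:R :> R.
Proof.
by rewrite /independent /= -mulnb natrM; case: (_ \subset _) => /=; ring.
Qed.

(** Harris's bound, by induction on the edges: independence from the other edges is a decreasing
    event, so given it an edge lies in [S] with probability at most [p ^+ 2]. *)
Lemma independent_ge es : {in es, forall e, #|e| = 2%N} ->
  (1 - p ^+ 2) ^+ size es <= E (fun S => (independent es S)%:R).
Proof.
elim: es => [|e es IH] h; first by rewrite expr0 bernoulli_mean1.
rewrite (eq_bernoulli_mean _ (independent_cons e es)) bernoulli_meanB /= [_ ^+ (size es).+1]exprS.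
have /andP[p0 p1] := p01.
apply: (@le_trans _ _ ((1 - p ^+ 2) * E (fun S => (independent es S)%:R))).
  apply: ler_wpM2l; first by nra.
  by apply: IH => e' he'; apply: h; rewrite inE he' orbT.
rewrite mulrBl mul1r lerB // bernoulli_mean_edge_le ?h ?mem_head //.
exact: independent_decreasing.
Qed.

(* The inductive step is the one of the Boppana-Spencer proof of Janson's
   inequality: given independence from the edges disjoint from [e], the event
   [e \subset S] still has probability [p ^+ 2], and each edge meeting [e] costs
   at most one more factor [p]. *)
Lemma independent_le D es : uniq es -> {in es, forall e, #|e| = 2%N} ->
  {in es, forall e, (count (fun e' => e :&: e' != finset.set0)%SET es <= D)%N} ->
  E (fun S => (independent es S)%:R) <=
    (1 - p ^+ 2 + D%:R * p ^+ 3) ^+ size es.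
Proof.
have /andP[p0 p1] := p01.
elim: es => [|e es IH]; first by move=> _ _ _; rewrite expr0 bernoulli_mean1.
rewrite cons_uniq => /andP[ees ues] c2 deg.
have {}IH : E (fun S => (independent es S)%:R) <=
    (1 - p ^+ 2 + D%:R * p ^+ 3) ^+ size es.
  apply: IH => // [e' he'|e' he']; first by apply: c2; rewrite inE he' orbT.
  by apply: leq_trans (deg e' _); rewrite ?inE ?he' ?orbT //= leq_addl.
pose near e' := (e :&: e' != finset.set0)%SET.
pose far := seq.filter (predC near) es.
have near_le : (size (seq.filter near es))%:R <= D%:R :> R.
  rewrite ler_nat size_filter; apply: leq_trans (deg e (mem_head _ _)).
  exact: leq_addl.
have split_es S : independent es S = independent (seq.filter near es) S && independent far S.
  by rewrite /independent -all_cat; apply: perm_all; rewrite perm_sym perm_filterC.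
have far_ge : E (fun S => (independent es S)%:R) <= E (fun S => (independent far S)%:R).
  apply: ler_bernoulli_mean => // S.
  by rewrite split_es ler_nat; case: (independent far S); rewrite ?andbF ?leq_b1.
pose g S := (e \subset S)%:R * (independent far S)%:R : R.
have e2 : #|e| = 2%N by apply: c2; rewrite mem_head.
have farE u S : u \in e -> independent far (u |: S)%SET = independent far S.
  move=> ue; apply: eq_in_all => e'; rewrite mem_filter /= negbK => /andP[/eqP de' _].
  have ue' : u \notin e'.
    apply/negP => ue'; have : u \in (e :&: e')%SET by rewrite inE ue ue'.
    by rewrite de' inE.
  congr (~~ _); apply/fintype.subsetP/fintype.subsetP => h x xe'; last by rewrite inE h ?orbT.
  by have := h x xe'; rewrite !inE => /orP[/eqP xu|//]; rewrite -xu xe' in ue'.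
have Eg : E g = p ^+ 2 * E (fun S => (independent far S)%:R).
  by apply: bernoulli_mean_edge => // u S ue _; rewrite farE.
have near_cost e' : e' \in seq.filter near es ->
    E (fun S => (e' \subset S)%:R * g S) <= p * E g.
  rewrite mem_filter => /andP[_ e'es].
  (* [e'] and [e] are distinct sets of size 2, so [e'] has an end outside [e]; its membership in [S]
     is the extra factor [p]. *)
  have [u ue' ue] : exists2 u, u \in e' & u \notin e.
    apply/fintype.subsetPn; apply: contra ees => sub.
    have <- // : e' = e; apply/eqP; rewrite eqEcard sub e2 c2 //.
    by rewrite inE e'es orbT.
  apply: le_trans (@bernoulli_mean_mem_le _ _ _ w01 u _ _); last first.
    move=> S uS; rewrite /g; have -> : (e \subset u |: S)%SET = (e \subset S).
      apply/fintype.subsetP/fintype.subsetP => h x xe; last by rewrite inE h ?orbT.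
      by have := h x xe; rewrite !inE => /orP[/eqP xu|//]; rewrite -xu xe in ue.
    by apply: ler_wpM2l => //; apply: independent_decreasing.
  apply: ler_bernoulli_mean => // S; apply: ler_wpM2r; first by rewrite /g mulr_ge0.
  by rewrite ler_nat; case: (boolP (e' \subset S)) => // /fintype.subsetP /(_ _ ue') ->.
(* Union bound over the edges meeting [e]: where [S] contains one of them, the subtracted sum is
   already at least [g S]. *)
have cost : E g - \sum_(e' <- seq.filter near es) E (fun S => (e' \subset S)%:R * g S)
    <= E (fun S => (e \subset S)%:R * (independent es S)%:R).
  rewrite -bernoulli_mean_sum -bernoulli_meanB; apply: ler_bernoulli_mean => // S.
  rewrite split_es; case: (boolP (independent (seq.filter near es) S)) => [_|].
    by rewrite lerBlDr lerDl sumr_ge0 // => e' _; rewrite /g !mulr_ge0.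
  rewrite -has_predC => /hasP[e' e'near] /=; rewrite negbK => e'S.
  rewrite mulr0 subr_le0 (big_rem e') //= e'S mul1r lerDl sumr_ge0 // => i _.
  by rewrite /g !mulr_ge0.
rewrite (eq_bernoulli_mean _ (independent_cons e es)) bernoulli_meanB /= [_ ^+ (size es).+1]exprS.
set Q := E (fun S => (independent es S)%:R) in IH far_ge *.
set F := E (fun S => (independent far S)%:R) in far_ge Eg *.
set X := E (fun S => (_ \subset _)%:R * _) in cost *.
have Q0 : 0 <= Q by apply: bernoulli_mean_ge0.
have X0 : 0 <= X by apply: bernoulli_mean_ge0 => // S; rewrite mulr_ge0.
have sum_le : \sum_(e' <- seq.filter near es) E (fun S => (e' \subset S)%:R * g S)
    <= D%:R * (p * E g).
  apply: (@le_trans _ _ (\sum_(e' <- seq.filter near es) p * E g)).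
    by rewrite !big_seq; apply: ler_sum => e' /near_cost.
  rewrite big_const_seq count_predT iter_addr_0 -[leLHS]mulr_natl.
  apply: ler_wpM2r near_le; rewrite Eg; apply: mulr_ge0 => //.
  by rewrite mulr_ge0 ?exprn_ge0 // (le_trans Q0).
apply: (@le_trans _ _ ((1 - p ^+ 2 + D%:R * p ^+ 3) * Q)); last first.
  apply: ler_wpM2l => //; have : 0 <= D%:R * p ^+ 3 by rewrite mulr_ge0 ?exprn_ge0.
  by nra.
(* If [D%:R * p] exceeds 1, the claimed factor is above 1 and [X >= 0] suffices. Otherwise
   [1 - D%:R * p] is nonnegative, and [F] can be bounded below by [Q]. *)
have [Dp|Dp] := leP (D%:R * p) 1; last first.
  suff : 0 <= (D%:R * p ^+ 3 - p ^+ 2) * Q by nra.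
  rewrite mulr_ge0 //; have -> : D%:R * p ^+ 3 - p ^+ 2 = p ^+ 2 * (D%:R * p - 1) by ring.
  by rewrite mulr_ge0 ?sqr_ge0 // subr_ge0 ltW.
have : p ^+ 2 * (1 - D%:R * p) * Q <= X.
  apply: (@le_trans _ _ (p ^+ 2 * (1 - D%:R * p) * F)).
    by apply: ler_wpM2l => //; rewrite mulr_ge0 ?sqr_ge0 // subr_ge0.
  apply: le_trans cost; apply: le_trans (lerB (lexx _) sum_le).
  by rewrite Eg le_eqVlt; apply/orP; left; apply/eqP; ring.
have -> : (1 - p ^+ 2 + D%:R * p ^+ 3) * Q = Q - p ^+ 2 * (1 - D%:R * p) * Q by ring.
by move=> h; rewrite lerB.
Qed.

End IndependentSets.

(** * The second moment method *)

Section SecondMoment.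
Context {R : realFieldType} {I J : finType}.
Variables (w : I -> R) (V : {set J}) (F : J -> {set I} -> bool) (rho : R).
Hypothesis w01 : forall i, 0 <= w i <= 1.
Local Notation E := (bernoulli_mean w).

(** Chebyshev's inequality for the number [X] of indices at which [F] holds: where none does,
    [(X - mu) ^+ 2] is [mu ^+ 2]. In the mean of [X ^+ 2] the diagonal gives [mu], the other pairs
    at most [rho * mu ^+ 2]. *)
Lemma second_moment mu : mu = \sum_(x in V) E (fun S => (F x S)%:R) ->
  0 <= rho ->
  {in V &, forall x y, x != y -> E (fun S => (F x S && F y S)%:R) <=
     rho * E (fun S => (F x S)%:R) * E (fun S => (F y S)%:R)} ->
  mu ^+ 2 * E (fun S => (~~ [exists x in V, F x S])%:R) <=
    mu + (rho - 1) * mu ^+ 2.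
Proof.
move=> muE rho0 corr.
pose X S : R := \sum_(x in V) (F x S)%:R.
have EX : E X = mu by rewrite /X bernoulli_mean_sum muE.
have EF0 x : 0 <= E (fun S => (F x S)%:R) by apply: bernoulli_mean_ge0.
have EX2 : E (fun S => X S ^+ 2) <= mu + rho * mu ^+ 2.
  rewrite (@eq_bernoulli_mean _ _ _ _ (fun S =>
      \sum_(x in V) \sum_(y in V) (F x S && F y S)%:R)); last first.
    move=> S; rewrite expr2 /X mulr_suml; apply: eq_bigr => x _.
    by rewrite mulr_sumr; apply: eq_bigr => y _; rewrite -natrM mulnb.
  rewrite bernoulli_mean_sum expr2 {3}muE mulrA mulr_sumr {1}muE -big_split /=.
  apply: ler_sum => x xV; rewrite bernoulli_mean_sum (bigD1 x) //=.
  apply: lerD.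
    by rewrite (@eq_bernoulli_mean _ _ _ _ (fun S => (F x S)%:R)) // => S; rewrite andbb.
  rewrite mulrAC muE [leRHS]mulr_sumr [leRHS](bigD1 x) //=.
  apply: ler_wpDl; first by rewrite !mulr_ge0.
  apply: ler_sum => y /andP[yV yx].
  by apply: le_trans (corr x y xV yV _) _; rewrite 1?eq_sym.
rewrite -bernoulli_meanZ.
apply: (@le_trans _ _ (E (fun S => X S ^+ 2 - 2 * mu * X S + mu ^+ 2 * 1))); last first.
  rewrite bernoulli_meanD bernoulli_meanB !bernoulli_meanZ EX bernoulli_mean1.
  move: EX2; set m2 := E (fun S => X S ^+ 2); nra.
apply: ler_bernoulli_mean => // S.
have -> : X S ^+ 2 - 2 * mu * X S + mu ^+ 2 * 1 = (X S - mu) ^+ 2 by ring.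
case: (boolP [exists x in V, F x S]) => [_|/existsPn noF]; first by rewrite mulr0 sqr_ge0.
have -> : X S = 0.
  rewrite /X big1 // => x xV; have := noF x; rewrite xV /=.
  by case: (F x S).
by rewrite sub0r sqrrN mulr1.
Qed.

End SecondMoment.

(** * Edge counts for a graph given by a relation *)

Section Edges.
Context {R : realFieldType} {I : finType}.
Variable r : rel I.

(** Edges are unordered pairs, so the two orientations of a related pair give one edge. *)
Definition edges : {set {set I}} :=
  [set [set u.1; u.2] | u in [pred u : I * I | r u.1 u.2]]%SET.

Lemma edgesP (e : {set I}) :
  reflect (exists s t, r s t /\ e = [set s; t]%SET) (e \in edges).
Proof.
apply: (iffP imsetP) => [[[s t]]|[s [t [rst ->]]]].
  by rewrite inE /= => rst ->; exists s, t.
by exists (s, t).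
Qed.

Lemma independent_edgesP (S : {set I}) :
  reflect (forall s t, r s t -> s \in S -> t \in S -> False)
    (independent (enum edges) S).
Proof.
apply: (iffP allP) => [h s t rst sS tS|h e].
  have /h : [set s; t]%SET \in enum edges.
    by rewrite mem_enum; apply/edgesP; exists s, t.
  by rewrite subset2E sS tS.
rewrite mem_enum => /edgesP[s [t [rst ->]]].
by rewrite subset2E; apply/negP => /andP[]; apply: h.
Qed.

Hypotheses (r_sym : symmetric r) (r_irr : irreflexive r).

Lemma card_edge (e : {set I}) : e \in edges -> #|e| = 2%N.
Proof.
move=> /edgesP[s [t [rst ->]]]; rewrite cards2.
by case: eqVneq => // st; rewrite st r_irr in rst.
Qed.

Lemma mem_edges s t : s != t -> [set s; t]%SET \in edges -> r s t.
Proof.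
move=> st /edgesP[a [b [rab /setP abE]]].
have := abE s; have := abE t; rewrite !inE !eqxx ?orbT /=.
move=> /esym/orP[] /eqP tE /esym/orP[] /eqP sE; rewrite ?sE ?tE ?eqxx // in st *.
by rewrite r_sym.
Qed.

Lemma card_incident_edges s : #|[set e in edges | s \in e]%SET| = #|r s|.
Proof.
have -> : [set e in edges | s \in e]%SET = [set [set s; t] | t in r s]%SET.
  apply/setP => e; rewrite inE; apply/andP/imsetP => [[/edgesP[a [b [rab ->]]]]|].
    rewrite !inE => /orP[] /eqP ->; first by exists b.
    by exists a; [rewrite unfold_in /= r_sym|rewrite finset.setUC].
  move=> [t rst ->]; split; last by rewrite !inE eqxx.
  by apply/edgesP; exists s, t.
apply: card_in_imset => t t' rst rst' /setP /(_ t).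
rewrite !inE eqxx orbT => /esym/orP[/eqP ts|/eqP //].
by rewrite ts unfold_in r_irr in rst.
Qed.

(** Handshake lemma: incident pairs of a vertex and an edge are counted in two ways. *)
Lemma sum_degrees : (\sum_s #|r s| = 2 * #|edges|)%N.
Proof.
under eq_bigr do rewrite -card_incident_edges -sum1_card.
under eq_bigr => s _ do under eq_bigl => e do rewrite inE.
rewrite (exchange_big_dep (mem edges)) /=; last by move=> s e _ /andP[].
rewrite mulnC -sum_nat_const; apply: eq_bigr => e eE.
by rewrite eE /= sum1_card; exact: card_edge.
Qed.

(** [bad] collects the vertices whose degree may fall short; by the handshake lemma each other
    vertex accounts for at least [d] edges. *)
Lemma card_edges_ge (bad : {set I}) (d : nat) :
  (forall s, s \notin bad -> 2 * d <= #|r s|)%N ->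
  (d * #|I| <= #|edges| + d * #|bad|)%N.
Proof.
move=> deg; have := sum_degrees.
have : (\sum_(s in ~: bad) 2 * d <= \sum_s #|r s|)%N%SET.
  rewrite [X in (_ <= X)%N](bigID (mem (~: bad)%SET)) /=.
  apply: leq_trans (leq_addr _ _); apply: leq_sum => s; rewrite finset.in_setC.
  exact: deg.
by rewrite sum_nat_const -(cardsC bad); nia.
Qed.

Lemma card_edges_le (d : nat) :
  (forall s, #|r s| <= 2 * d)%N -> (#|edges| <= d * #|I|)%N.
Proof.
move=> deg; have := sum_degrees.
have : (\sum_s #|r s| <= \sum_(s : I) 2 * d)%N by apply: leq_sum => s _.
by rewrite sum_nat_const => + sumE; rewrite sumE mulnCA leq_pmul2l // mulnC.
Qed.

(** An edge meeting [e] is incident with one of the two ends of [e]. Hence the [2 * D] in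
    [independent_edges_le]. *)
Lemma count_incident_edges D (e : {set I}) : (forall s, #|r s| <= D)%N -> e \in edges ->
  (count (fun e' => e :&: e' != finset.set0)%SET (enum edges) <= 2 * D)%N.
Proof.
move=> deg /edgesP[s [t [rst ->]]].
rewrite -size_filter -filter_predI -cardE; last first.
set A := (X in #|X|).
have : (#|A| <= #|[set e in edges | s \in e] :|: [set e in edges | t \in e]|)%N%SET.
  apply/subset_leq_card/fintype.subsetP => e'; rewrite /A !inE => /andP[/set0Pn[x]].
  by rewrite !inE => /andP[/orP[] /eqP -> ->] ->; rewrite ?orbT.
move/leq_trans; apply; apply: leq_trans (leq_card_setU _ _) _.
by rewrite !card_incident_edges mul2n -addnn leq_add.
Qed.

Variable p : R.
Hypothesis p01 : 0 <= p <= 1.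
Local Notation E := (@bernoulli_mean R I (fun=> p)).

Lemma independent_edges_ge :
  (1 - p ^+ 2) ^+ #|edges| <= E (fun S => (independent (enum edges) S)%:R).
Proof.
rewrite cardE; apply: independent_ge => // e; rewrite mem_enum; exact: card_edge.
Qed.

Lemma independent_edges_le D : (forall s, #|r s| <= D)%N ->
  E (fun S => (independent (enum edges) S)%:R) <=
    (1 - p ^+ 2 + (2 * D)%:R * p ^+ 3) ^+ #|edges|.
Proof.
move=> deg; rewrite cardE; apply: independent_le => //; first exact: enum_uniq.
  by move=> e; rewrite mem_enum; exact: card_edge.
by move=> e; rewrite mem_enum; exact: count_incident_edges.
Qed.

End Edges.

Lemma involutionV (gT : finGroupType) (x : gT) : (x ^+ 2 = 1 -> x^-1 = x)%g.
Proof. by move=> x2; apply: (mulgI x); rewrite mulgV -x2 expgS expg1. Qed.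

(** * Diameter 2 in terms of independence in [translates x] *)

Section CayleyGraph.
Context {R : realType} {gT : finGroupType}.
Implicit Types (x g h : gT) (S : {set gT}).

Lemma cayley_probE (p : R) (P : pred (rel gT)) :
  cayley_prob p P = bernoulli_mean (fun=> p) (fun S => (P (cayley_graph S))%:R).
Proof.
rewrite /cayley_prob /bernoulli_mean big_mkcond; apply: eq_bigr => S _.
by case: (P _); rewrite ?mulr1 ?mulr0.
Qed.

Lemma cayley_edgeE S g h : cayley_graph S g h =
  (g != h) && ((h * g^-1 \in S)%g || ((h * g^-1)^-1 \in S)%g).
Proof. by rewrite /cayley_graph invMg invgK. Qed.

Hypothesis mulC : forall x y : gT, (x * y = y * x)%g.

Definition translate_nbrs x s : {set gT} :=
  [set x * s; x * s^-1; x^-1 * s; x^-1 * s^-1]%g.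

(* [S] spans an edge of this graph iff [x] is a product of two elements of
   [S :|: S^-1] coming from distinct elements of [S]. *)
Definition translates x : rel gT :=
  fun s t => (s != t) && (t \in translate_nbrs x s).

Lemma translate_nbrsP x s t :
  reflect [\/ t = (x * s)%g, t = (x * s^-1)%g, t = (x^-1 * s)%g | t = (x^-1 * s^-1)%g]
    (t \in translate_nbrs x s).
Proof.
rewrite !inE -!orbA; apply: (iffP or4P).
  by case=> /eqP ->; [constructor 1|constructor 2|constructor 3|constructor 4].
by case=> ->; rewrite eqxx; [constructor 1|constructor 2|constructor 3|constructor 4].
Qed.

Lemma translates_irr x : irreflexive (translates x).
Proof. by move=> s; rewrite /translates eqxx. Qed.

(** Solving for [s] exchanges the forms [x * s] and [x^-1 * s], and by commutativity preserves each
    of the other two. *)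
Lemma translates_sym x : symmetric (translates x).
Proof.
suff imp s t : t \in translate_nbrs x s -> s \in translate_nbrs x t.
  by move=> s t; rewrite /translates eq_sym; congr (_ && _); apply/idP/idP; apply: imp.
move=> /translate_nbrsP[] ->; apply/translate_nbrsP.
- by constructor 3; rewrite mulKg.
- by constructor 2; rewrite invMg invgK (mulC s) mulKVg.
- by constructor 1; rewrite mulKVg.
- by constructor 4; rewrite invMg !invgK (mulC s) mulKg.
Qed.

Lemma translates_degree x s : (#|translates x s| <= 4)%N.
Proof.
apply: (@leq_trans #|translate_nbrs x s|).
  by apply/subset_leq_card/fintype.subsetP => t /andP[].
rewrite /translate_nbrs.
by do 3 (apply: leq_trans (leq_card_setU _ _) _; rewrite cards1 ?addn1 ?ltnS) => //; rewrite cards1.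
Qed.

Lemma graph_dist_le (T : finType) (e : rel T) (x y : T) (s : seq T) (n : nat) :
  path e x s -> last x s = y -> (size s <= n)%N ->
  (graph_dist R e x y <= n%:R%:E)%E.
Proof.
move=> pth lst sn; apply: (@le_trans _ _ (size s)%:R%:E); last by rewrite lee_fin ler_nat.
by apply: ereal_inf_lbound; exists s.
Qed.

(** For [x = h * g^-1], an edge of [translates x] inside [S] writes [x] as [a * b] with both factors
    in [S] up to inversion; then [g], [b * g], [h] is a walk. *)
Lemma diameter_le2 S :
  (forall x, x != 1%g -> ~~ independent (enum (edges (translates x))) S) ->
  (diameter R (cayley_graph S) <= 2%:E)%E.
Proof.
move=> cov; apply: ge_ereal_sup => _ [[g h] _ <-] /=.
have [<-|gh] := eqVneq g h; first exact: (@graph_dist_le _ _ _ _ [::]).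
have x1 : (h * g^-1 != 1)%g by rewrite -eq_mulgV1 eq_sym.
have [s [t [sS tS]]] : exists s t, [/\ s \in S, t \in S & translates (h * g^-1)%g s t].
  move/(_ _ x1): cov; apply: contraNP => no; apply/independent_edgesP => s t rst sS tS.
  by apply: no; exists s, t.
move=> /andP[_ /translate_nbrsP ts].
pose sym a := (a \in S) || (a^-1 \in S)%g.
have [a [b [hab syma symb]]] : exists a b, [/\ (h = a * b * g)%g, sym a & sym b].
  have hE : (h = h * g^-1 * g)%g by rewrite mulgKV.
  move: ts hE; set x := (h * g^-1)%g => ts ->.
  (* Each of the four forms of [t] is solved for [x]. *)
  case: ts => ts; [exists t, s^-1%g|exists t, s|exists t^-1%g, s|exists t^-1%g, s^-1%g];
    rewrite /sym ?invgK ?sS ?tS ?orbT; split=> //; congr (_ * g)%g; rewrite ts.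
  - by rewrite mulgK.
  - by rewrite mulgKV.
  - by rewrite invMg invgK (mulC _ x) mulgKV.
  - by rewrite invMg !invgK (mulC s) mulgK.
have step k a' : sym a' -> a' != 1%g -> cayley_graph S k (a' * k)%g.
  move=> sa a1; rewrite cayley_edgeE mulgK -/(sym a') sa andbT.
  by apply: contra a1 => /eqP kE; rewrite -(mulgK k a') -kE mulgV.
(* The Cayley graph has no loops, so an identity factor must be dropped; what remains is a walk of
   one edge. *)
have [a1|a1] := eqVneq a 1%g.
  have hb : h = (b * g)%g by rewrite hab a1 mul1g.
  apply: (@graph_dist_le _ _ _ _ [:: h]) => //=; rewrite andbT hb step //.
  by apply: contra gh => /eqP b1; rewrite hb b1 mul1g.
have [b1|b1] := eqVneq b 1%g.
  have ha : h = (a * g)%g by rewrite hab b1 mulg1.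
  by apply: (@graph_dist_le _ _ _ _ [:: h]) => //=; rewrite andbT ha step.
by apply: (@graph_dist_le _ _ _ _ [:: b * g; h]%g) => //=; rewrite hab -mulgA !step.
Qed.

(** The far pair is [1] and [x]. A walk of length 1 would put [x = x^-1] in [S]. A walk of length 2
    would give two elements of [S] that are adjacent in [translates x], or that coincide, and then
    [x] would be a square or [1]. *)
Lemma diameter_gt2 x S : x != 1%g -> (x ^+ 2 = 1)%g -> (forall s, s ^+ 2 != x)%g ->
  x \notin S -> independent (enum (edges (translates x))) S ->
  (2%:E < diameter R (cayley_graph S))%E.
Proof.
move=> x1 x2 nsq xS /independent_edgesP ind.
have xV := involutionV x2.
suff far : (3%:E <= graph_dist R (cayley_graph S) 1%g x)%E.
  apply: (@lt_le_trans _ _ 3%:E); first by rewrite lte_fin ltr_nat.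
  by apply: le_trans far _; apply: ereal_sup_ubound; exists (1%g, x).
apply: le_ereal_inf_tmp => _ [s [pth lst] <-]; rewrite lee_fin ler_nat.
case: s pth lst => [_ /= x1'|a [|b [|//]]]; first by rewrite -x1' eqxx in x1.
  rewrite /= andbT cayley_edgeE => /andP[_]; rewrite invg1 mulg1 => + ax.
  by rewrite ax xV orbb (negbTE xS).
rewrite /= andbT !cayley_edgeE invg1 mulg1 => + bx; rewrite bx.
move=> /andP[/andP[_ aS] /andP[_ xaS]].
(* Both steps of the walk are replaced by members of [S], up to inversion; as [x = x^-1], the
   inverse of [x * a^-1] is [x * a]. *)
have [a' a'S aE] : exists2 a', a' \in S & a = a' \/ a = a'^-1%g.
  by case/orP: aS => h; [exists a|exists a^-1%g]; rewrite ?invgK //; [left|right].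
have [b' b'S bE] : exists2 b', b' \in S & b' = (x * a'^-1)%g \/ b' = (x * a')%g.
  have h : ((x * a^-1)^-1 = x * a)%g by rewrite invMg invgK xV mulC.
  case/orP: xaS => h'; rewrite ?h in h'; eexists; try exact: h'.
    by case: aE => ->; rewrite ?invgK; [left|right].
  by case: aE => ->; [right|left].
have [ab|ab] := eqVneq a' b'.
  case: bE => bE.
    by have := nsq a'; rewrite expgS expg1 {1}ab bE mulgKV eqxx.
  by move: x1; rewrite -(mulgK a' x) -bE -ab mulgV eqxx.
exfalso; apply: (ind a' b') => //; rewrite /translates ab /=.
by apply/translate_nbrsP; case: bE => ->; [constructor 2|constructor 1].
Qed.

End CayleyGraph.

(** * Edge counts of [translates x] and the union bound *)

Section AbelianCayley.
Context {R : realType} {gT : finGroupType}.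
Hypothesis mulC : forall x y : gT, (x * y = y * x)%g.
Implicit Types (x y s t : gT) (S V : {set gT}) (p q : R).

Definition square_roots x : {set gT} := [set s | s ^+ 2 == x]%g.
Local Notation tau := #|square_roots 1%g|.

(** By commutativity the square roots of [x], if any, form a coset of those of [1]. *)
Lemma card_square_roots x : (#|square_roots x| <= tau)%N.
Proof.
have [->|[s0]] := set_0Vmem (square_roots x); first by rewrite cards0.
rewrite inE => /eqP s0x.
rewrite -(card_imset _ (@mulIg _ s0^-1%g)); apply/subset_leq_card/fintype.subsetP.
move=> _ /imsetP[s + ->]; rewrite !inE => /eqP sx.
by rewrite expgMn ?expgVn ?sx ?s0x ?mulgV //; exact: mulC.
Qed.

Lemma square_eqE s t u : (s * t = u * t^-1 -> t ^+ 2 = s^-1 * u)%g.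
Proof.
by move=> h; rewrite expgS expg1 -{1}(mulKg s t) h -mulgA mulgKV.
Qed.

(** When [x ^+ 2 != 1], two of the four candidate neighbours agree, or one of them is [s] itself,
    only if [s ^+ 2] is one of [1], [x ^+ 2], [x ^- 2], [x], [x^-1]. *)
Lemma translates_degree_ge x s : (x ^+ 2 != 1)%g ->
  s \notin (square_roots 1 :|: square_roots (x ^+ 2) :|: square_roots (x ^- 2)
     :|: square_roots x :|: square_roots x^-1)%g%SET ->
  (4 <= #|translates x s|)%N.
Proof.
move=> x2; rewrite !inE !negb_or -!andbA => /and5P[s1 sx2 sxN2 sx sxN].
have xN : x <> x^-1%g by move=> h; move/eqP: x2; apply; rewrite expgS expg1 {2}h mulgV.
have x1 : x <> 1%g by move=> h; move/eqP: x2; apply; rewrite h expg1n.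
have sN : s <> s^-1%g by move=> h; move/eqP: s1; apply; rewrite expgS expg1 {2}h mulgV.
pose l := [:: x * s; x * s^-1; x^-1 * s; x^-1 * s^-1]%g.
rewrite (_ : 4%N = size l) // -(card_uniqP (_ : uniq l)).
  apply/subset_leq_card/fintype.subsetP => t tl.
  have tn : t \in translate_nbrs x s by move: tl; rewrite /l !inE -!orbA.
  rewrite unfold_in /= /translates tn andbT; apply/eqP => st.
  case/translate_nbrsP: tn => h; rewrite -st in h.
  - by apply: x1; apply: (mulIg s); rewrite -h mul1g.
  - by move/eqP: sx; apply; rewrite expgS expg1 {1}h mulgKV.
  - by apply: x1; apply: invg_inj; apply: (mulIg s); rewrite -h invg1 mul1g.
  - by move/eqP: sxN; apply; rewrite expgS expg1 {1}h mulgKV.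
rewrite /l /= !inE !negb_or -!andbA andbT; do 5 ?[apply/andP; split]; apply/eqP => h.
- by apply: sN; apply: mulgI h.
- by apply: xN; apply: mulIg h.
- by move/eqP: sxN2; apply; rewrite (square_eqE h) expgS expg1 invMg.
- by move/eqP: sx2; apply; rewrite (square_eqE (esym h)) invgK expgS expg1.
- by apply: xN; apply: mulIg h.
- by apply: sN; apply: mulgI h.
Qed.

(** The five classes of exceptional vertices have at most [tau] elements each, and each vertex
    counts for half of the degree 4. *)
Lemma card_edges_translates x : (x ^+ 2 != 1)%g ->
  (2 * #|gT| <= #|edges (translates x)| + 10 * tau)%N.
Proof.
move=> x2.
set bad := (square_roots 1 :|: square_roots (x ^+ 2) :|: square_roots (x ^- 2)
     :|: square_roots x :|: square_roots x^-1)%g%SET.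
have badle : (#|bad| <= 5 * tau)%N.
  rewrite /bad; do 4 (apply: leq_trans (leq_card_setU _ _) _;
    rewrite mulSn addnC; apply: leq_add (card_square_roots _) _).
  by rewrite mul1n.
have := card_edges_ge (translates_sym mulC x) (@translates_irr _ x) (bad := bad) (d := 2).
move=> /(_ (fun s => @translates_degree_ge x s x2)) /leq_trans; apply.
by rewrite leq_add2l (_ : 10 = 2 * 5)%N // -mulnA leq_pmul2l.
Qed.

Lemma translate_nbrs_involution x s : (x ^+ 2 = 1)%g ->
  translate_nbrs x s = [set x * s; x * s^-1]%g%SET.
Proof.
move=> x2; apply/setP => t; rewrite !inE (involutionV x2) -!orbA.
by do 2 case: (t == _).
Qed.

(** For an involution only the candidates [x * s] and [x * s^-1] are left. They agree when
    [s ^+ 2 = 1], and the second is [s] when [s ^+ 2 = x]. *)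
Lemma card_edges_involution_ge x : x != 1%g -> (x ^+ 2 = 1)%g ->
  (#|gT| <= #|edges (translates x)| + 2 * tau)%N.
Proof.
move=> x1 x2.
set bad := (square_roots 1 :|: square_roots x)%g%SET.
have badle : (#|bad| <= 2 * tau)%N.
  apply: leq_trans (leq_card_setU _ _) _.
  by rewrite mulSn mul1n leq_add2l card_square_roots.
have deg s : s \notin bad -> (2 * 1 <= #|translates x s|)%N.
  rewrite !inE negb_or => /andP[s1 sx].
  have ne : (x * s != x * s^-1)%g.
    apply: contra s1 => /eqP/mulgI h; apply/eqP.
    by rewrite expgS expg1 {2}h mulgV.
  rewrite (_ : (2 * 1)%N = #|[set x * s; x * s^-1]%g%SET|); last by rewrite cards2 ne.
  apply/subset_leq_card/fintype.subsetP => t.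
  rewrite -translate_nbrs_involution // => tn.
  suff: translates x s t by [].
  rewrite /translates tn andbT; apply/eqP => st; move: tn.
  rewrite translate_nbrs_involution // !inE -st => /orP[] /eqP h.
    by move/eqP: x1; apply; apply: (mulIg s); rewrite -h mul1g.
  by move/eqP: sx; apply; rewrite expgS expg1 {1}h mulgKV.
have := card_edges_ge (translates_sym mulC x) (@translates_irr _ x) deg.
by rewrite !mul1n => /leq_trans; apply; rewrite leq_add2l.
Qed.

Lemma card_edges_involution_le x : (x ^+ 2 = 1)%g ->
  (#|edges (translates x)| <= #|gT|)%N.
Proof.
move=> x2; rewrite -[#|gT|]mul1n; apply: card_edges_le => [||s].
- exact: translates_sym.
- exact: translates_irr.
apply: leq_trans (_ : #|[set x * s; x * s^-1]%g%SET| <= 2)%N.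
  rewrite -translate_nbrs_involution //.
  by apply/subset_leq_card/fintype.subsetP => t /andP[].
by rewrite cards2; case: eqP.
Qed.

Lemma cayley_prob_diameter_le2E p :
  cayley_prob p (fun e : rel gT => (diameter R e <= 2%:E)%E) =
  1 - cayley_prob p (fun e : rel gT => (2%:E < diameter R e)%E).
Proof.
rewrite !cayley_probE -[X in _ = X - _](@bernoulli_mean1 _ gT (fun=> p)) -bernoulli_meanB.
by apply: eq_bernoulli_mean => S; rewrite leNgt; case: (_ < _)%E; rewrite ?subrr ?subr0.
Qed.

Lemma cayley_prob_ge0 p (P : pred (rel gT)) : 0 <= p <= 1 -> 0 <= cayley_prob p P.
Proof. by move=> p01; rewrite cayley_probE; apply: bernoulli_mean_ge0. Qed.

(** Union bound over [x != 1], split by whether [x ^+ 2 = 1]. Independence is a decreasing event, so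
    [p] may be lowered to some [q] with [8 * q <= 1], which keeps the base of the powers at most 1.
    The coefficient 8 is twice the degree bound 4. *)
Lemma cayley_prob_diameter_gt2_le p q : 0 <= q -> q <= p -> p <= 1 -> 8 * q <= 1 ->
  cayley_prob p (fun e : rel gT => (2%:E < diameter R e)%E) <=
    tau%:R * (1 - q ^+ 2 + 8 * q ^+ 3) ^+ (#|gT| - 2 * tau) +
    #|gT|%:R * (1 - q ^+ 2 + 8 * q ^+ 3) ^+ (2 * #|gT| - 10 * tau).
Proof.
move=> q0 qp p1 q8.
have p01 : 0 <= p <= 1 by rewrite p1 andbT (le_trans q0).
have q01 : 0 <= q <= 1 by rewrite q0 (le_trans qp).
set a := 1 - q ^+ 2 + 8 * q ^+ 3.
have a01 : 0 <= a <= 1 by rewrite /a; nra.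
have /andP[a0 a1] := a01.
pose ind x S := independent (enum (edges (translates x))) S.
apply: (@le_trans _ _ (\sum_(x | x != 1%g) bernoulli_mean (fun=> p) (fun S => (ind x S)%:R))).
  rewrite cayley_probE -bernoulli_mean_sum; apply: ler_bernoulli_mean => // S.
  case: ltP => [d2|_]; last by apply: sumr_ge0.
  have [x x1 ix] : exists2 x, x != 1%g & ind x S.
    apply: contraPP d2 => no; apply/negP; rewrite -leNgt.
    apply: diameter_le2 => // x x1; apply/negP => ix; apply: no; exists x => //.
  by rewrite (bigD1 x) //= ix lerDl sumr_ge0.
have bnd x : bernoulli_mean (fun=> p) (fun S => (ind x S)%:R) <= a ^+ #|edges (translates x)|.
  apply: (@le_trans _ _ (bernoulli_mean (fun=> q) (fun S => (ind x S)%:R))).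
    by apply: bernoulli_mean_anti => //; exact: independent_decreasing.
  exact: (independent_edges_le (translates_sym mulC x) (@translates_irr _ x) q01
    (translates_degree x)).
rewrite (bigID (fun x => x \in square_roots 1)%g) /=; apply: lerD.
  apply: (@le_trans _ _ (\sum_(x in square_roots 1%g) a ^+ (#|gT| - 2 * tau))); last first.
    by rewrite sumr_const mulr_natl.
  rewrite [leRHS](bigID (fun x => x != 1%g)) /=; apply: ler_wpDr.
    by apply: sumr_ge0 => *; apply: exprn_ge0.
  rewrite (eq_bigl (fun x => (x \in square_roots 1%g) && (x != 1%g))); last first.
    by move=> x; rewrite andbC.
  apply: ler_sum => x /andP[]; rewrite inE => /eqP x2 x1; apply: le_trans (bnd x) _.
  by apply: ler_wiXn2l => //; rewrite leq_subLR addnC card_edges_involution_ge.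
apply: (@le_trans _ _ (\sum_(x : gT) a ^+ (2 * #|gT| - 10 * tau))); last first.
  by rewrite sumr_const mulr_natl.
rewrite [leRHS](bigID (fun x => (x != 1%g) && (x \notin square_roots 1%g))) /=.
apply: ler_wpDr; first by apply: sumr_ge0 => *; apply: exprn_ge0.
apply: ler_sum => x /andP[_]; rewrite inE => x2; apply: le_trans (bnd x) _.
by apply: ler_wiXn2l => //; rewrite leq_subLR addnC card_edges_translates.
Qed.

End AbelianCayley.

(** * Second moment bound from a family of involutions *)

Section SumFree.
Context {R : realType} {gT : finGroupType}.
Hypothesis mulC : forall x y : gT, (x * y = y * x)%g.
Implicit Types (x y s t : gT) (S : {set gT}).

(** A common edge at [s] equates [x * s] or [x * s^-1] with [y * s] or [y * s^-1]: equal exponents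
    of [s] force [x = y], opposite ones make [s] a square root of [x * y]. *)
Lemma edges_translates_disjoint x y : (x ^+ 2 = 1)%g -> (y ^+ 2 = 1)%g -> x != y ->
  (forall s, s ^+ 2 != x * y)%g ->
  [disjoint edges (translates x) & edges (translates y)].
Proof.
move=> x2 y2 xy nsq; apply/pred0P => e /=; apply/negP => /andP[].
move=> /edgesP[s [t [/andP[st tx] ->]]].
move=> /(mem_edges (translates_sym mulC y) st) /andP[_].
have xV := involutionV x2.
have yV := involutionV y2.
move: tx; rewrite !translate_nbrs_involution // !inE.
move=> /orP[] /eqP -> /orP[] /eqP h.
- by move/mulIg: h xy => ->; rewrite eqxx.
- by have := nsq s; rewrite (square_eqE h) xV eqxx.
- by have := nsq s; rewrite (square_eqE (esym h)) yV mulC eqxx.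
- by move/mulIg: h xy => ->; rewrite eqxx.
Qed.

Variables (p : R) (V : {set gT}).
Hypotheses (p0 : 0 <= p) (p1 : p < 1).
Hypothesis V_involution : {in V, forall x, x != 1 /\ x ^+ 2 = 1}%g.
Hypothesis V_nonsquare : {in V, forall x s, s ^+ 2 != x}%g.
Hypothesis V_sumfree : {in V &, forall x y, x != y -> forall s, s ^+ 2 != x * y}%g.
Local Notation E := (@bernoulli_mean R gT (fun=> p)).

Let p01 : 0 <= p <= 1. Proof. by rewrite p0 ltW. Qed.

(** For [x] in [V], the first condition excludes an edge from [1] to [x], the second a walk of
    length 2. *)
Definition uncovered x S :=
  (x \notin S) && independent (enum (edges (translates x))) S.

Lemma uncovered_ge x :
  (1 - p) * (1 - p ^+ 2) ^+ #|edges (translates x)| <= E (fun S => (uncovered x S)%:R).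
Proof.
apply: (@le_trans _ _ ((1 - p) *
    E (fun S => (independent (enum (edges (translates x))) S)%:R))).
  apply: ler_wpM2l; first by rewrite subr_ge0 ltW.
  by apply: independent_edges_ge => //; exact: translates_irr.
rewrite (@eq_bernoulli_mean _ _ _ (fun S => (uncovered x S)%:R) (fun S => (x \notin S)%:R *
  (independent (enum (edges (translates x))) S)%:R)).
  by apply: bernoulli_mean_notin_ge => //; exact: independent_decreasing.
by move=> S; rewrite -natrM mulnb.
Qed.

(** Both events together make [S] independent in the union of the two graphs, which has degree at
    most 8 and whose edge counts add up by disjointness. *)
Lemma uncovered2_le x y : x \in V -> y \in V -> x != y ->
  E (fun S => (uncovered x S && uncovered y S)%:R) <=
  (1 - p ^+ 2 + 16 * p ^+ 3) ^+ (#|edges (translates x)| + #|edges (translates y)|).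
Proof.
move=> xV yV xy.
pose r := [rel s t | translates x s t || translates y s t].
have r_sym : symmetric r by move=> s t; rewrite /= !(translates_sym mulC _ s t).
have r_irr : irreflexive r by move=> s; rewrite /= !translates_irr.
have rdeg s : (#|r s| <= 8)%N.
  apply: (@leq_trans (#|translates x s| + #|translates y s|)); last first.
    by rewrite (_ : 8 = 4 + 4)%N // leq_add // translates_degree.
  by rewrite -cardUI; apply: leq_trans (leq_addr _ _); apply: subset_leq_card.
have rE : edges r = (edges (translates x) :|: edges (translates y))%SET.
  apply/setP => e; rewrite finset.in_setU; apply/edgesP/orP => [[s [t [/orP[] rst ->]]]|].
  - by left; apply/edgesP; exists s, t.
  - by right; apply/edgesP; exists s, t.
  case=> /edgesP[s [t [rst ->]]]; exists s, t; split=> //=; rewrite rst ?orbT //.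
have [/= x1 x2] := V_involution xV; have [/= y1 y2] := V_involution yV.
have -> : (#|edges (translates x)| + #|edges (translates y)|)%N = #|edges r|.
  rewrite rE cardsU (eqP (_ : _ :&: _ == finset.set0)%SET) ?cards0 ?subn0 //.
  rewrite finset.setI_eq0; apply: edges_translates_disjoint => //; exact: V_sumfree.
apply: le_trans (independent_edges_le r_sym r_irr p01 rdeg).
apply: ler_bernoulli_mean => // S; rewrite ler_nat.
case: (boolP (_ && _)) => // /andP[/andP[_ /independent_edgesP ix] /andP[_ /independent_edgesP iy]].
rewrite lt0b; apply/independent_edgesP => s t /orP[]; [exact: ix|exact: iy].
Qed.

(** [rho] is the quotient of the upper bound for pairs by the product of two lower bounds, taken at
    the largest possible edge count [#|gT|] of each graph. Dividing [second_moment] by [mu ^+ 2]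
    leaves [mu^-1 + (rho - 1)]. *)
Lemma cayley_prob_diameter_le2_le : (0 < #|V|)%N ->
  cayley_prob p (fun e : rel gT => (diameter R e <= 2%:E)%E) <=
  (#|V|%:R * ((1 - p) * (1 - p ^+ 2) ^+ #|gT|))^-1 +
  (((1 - p ^+ 2 + 16 * p ^+ 3) / (1 - p ^+ 2)) ^+ (2 * #|gT|) / (1 - p) ^+ 2 - 1).
Proof.
move=> V0.
set a := 1 - p ^+ 2 + 16 * p ^+ 3; set b := 1 - p ^+ 2.
set rho := _ / (1 - p) ^+ 2; set mu0 := #|V|%:R * _.
have b0 : 0 < b by rewrite subr_gt0 expr_lt1.
have b1 : b <= 1 by rewrite gerBl sqr_ge0.
have p'0 : 0 < 1 - p by rewrite subr_gt0.
have ab : 1 <= a / b.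
  rewrite ler_pdivlMr // mul1r /a -/b lerDl mulr_ge0 // exprn_ge0 //.
have rho0 : 0 <= rho.
  by rewrite divr_ge0 ?exprn_ge0 ?(ltW p'0) // (le_trans _ ab).
pose mu := \sum_(x in V) E (fun S => (uncovered x S)%:R).
have muV : mu0 <= mu.
  rewrite /mu0 mulr_natl -sumr_const; apply: ler_sum => x xV.
  apply: le_trans (uncovered_ge x); rewrite ler_pM2l //.
  have [_ x2] := V_involution xV.
  apply: ler_wiXn2l; rewrite ?(ltW b0) //; exact: card_edges_involution_le.
have mu00 : 0 < mu0 by rewrite !mulr_gt0 ?exprn_gt0 // ltr0n.
have mu_gt0 : 0 < mu by apply: lt_le_trans muV.
have corr : {in V &, forall x y, x != y ->
    E (fun S => (uncovered x S && uncovered y S)%:R) <=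
     rho * E (fun S => (uncovered x S)%:R) * E (fun S => (uncovered y S)%:R)}.
  move=> x y xV yV xy; apply: le_trans (uncovered2_le xV yV xy) _.
  set kx := #|edges (translates x)|; set ky := #|edges (translates y)|.
  have [_ x2] := V_involution xV; have [_ y2] := V_involution yV.
  have kxy : (kx + ky <= 2 * #|gT|)%N.
    by rewrite mul2n -addnn leq_add // card_edges_involution_le.
  apply: (@le_trans _ _ (rho * (((1 - p) * b ^+ kx) * ((1 - p) * b ^+ ky)))).
    have -> : rho * (((1 - p) * b ^+ kx) * ((1 - p) * b ^+ ky)) =
        (a / b) ^+ (2 * #|gT|) * b ^+ (kx + ky).
      rewrite /rho exprD; move: ((a / b) ^+ _) (b ^+ kx) (b ^+ ky) => u v z.
      by field; exact: lt0r_neq0.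
    (* As [a / b] is at least 1, its exponent may be raised from [kx + ky] to [2 * #|gT|]. *)
    rewrite -[leLHS](mulfVK (_ : b ^+ (kx + ky) != 0)); last first.
      by rewrite expf_neq0 // lt0r_neq0.
    rewrite -expr_div_n; apply: ler_wpM2r; first by rewrite exprn_ge0 // ltW.
    exact: ler_weXn2l.
  rewrite -[leRHS]mulrA; apply: ler_wpM2l => //; apply: ler_pM; rewrite ?uncovered_ge //.
    by rewrite mulr_ge0 ?exprn_ge0 ?ltW.
  by rewrite mulr_ge0 ?exprn_ge0 ?ltW.
have := second_moment (fun=> p01) (erefl mu) rho0 corr.
set P := E _ => bnd.
apply: (@le_trans _ _ P).
  rewrite cayley_probE; apply: ler_bernoulli_mean => // S; rewrite ler_nat.
  case: (boolP [exists _ in _, _]) => [/existsP[x /andP[xV /andP[xS iS]]]|_]; last exact: leq_b1.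
  have [x1 x2] := V_involution xV.
  by rewrite leNgt (diameter_gt2 mulC x1 x2 (V_nonsquare xV) xS iS).
apply: (@le_trans _ _ (mu^-1 + (rho - 1))); last by rewrite lerD2r lef_pV2.
rewrite -(ler_pM2l (exprn_gt0 2 mu_gt0)); apply: le_trans bnd _.
by rewrite mulrDr [_ * (rho - 1)]mulrC lerD2r expr2 mulfK // lt0r_neq0.
Qed.

End SumFree.

(** * Squares and involutions in the product groups *)

Section C2nCm.

Lemma cyclic_groupC m (x y : cyclic_group m) : (x * y = y * x)%g.
Proof. exact: (addrC (x : 'I_m.-1.+1)). Qed.

(** [k + k] is a multiple of the order and less than twice the order, so [k] is zero or half of the
    order. *)
Lemma card_cyclic_square_roots m :
  (#|[set k : cyclic_group m | k * k == 1]%g%SET| <= 2)%N.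
Proof.
apply: (@leq_trans #|[set (ord0 : 'I_m.-1.+1); inord (m.-1.+1)./2]%SET|); last first.
  by rewrite cards2; case: eqP.
apply/subset_leq_card/fintype.subsetP => k; rewrite !inE => /eqP kk.
have := congr1 (@nat_of_ord _) (kk : (k : 'I_m.-1.+1) + k = ord0).
rewrite /= => kk0; have km := ltn_ord k.
have [k0|k0] := eqVneq (k : nat) 0%N; first by apply/orP; left; apply/eqP/val_inj.
apply/orP; right; apply/eqP/val_inj; rewrite /= inordK; last by lia.
have : (k + k = m.-1.+1)%N; last by lia.
have /dvdnP[[|[|q]]] : (m.-1.+1 %| k + k)%N by apply/eqP.
- by lia.
- by lia.
- by nia.
Qed.

Lemma group_powerC n (f g : group_power (cyclic_group 2) n) : (f * g = g * f)%g.
Proof. by apply/ffunP => i; rewrite !dffunM; exact: cyclic_groupC. Qed.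

Lemma group_power_square n (f : group_power (cyclic_group 2) n) : (f * f = 1)%g.
Proof.
apply/ffunP => i; rewrite dffunM ffunE.
by apply/val_inj; case: (f i) => [[|[|//]]].
Qed.

Lemma card_group_power n : #|group_power (cyclic_group 2) n| = (2 ^ n)%N.
Proof. by rewrite card_ffun !card_ord. Qed.

Context {R : realType} (c : R) (n : nat).
Local Notation G := (C2n_Cm c n).
Local Notation m := (cyclic_factor_order c n).

Lemma C2n_CmC (x y : G) : (x * y = y * x)%g.
Proof.
by apply: injective_projections; [exact: group_powerC|exact: cyclic_groupC].
Qed.

Lemma C2n_Cm_square (x : G) : (x ^+ 2 = (1, x.2 * x.2))%g.
Proof.
by rewrite expgS expg1; apply: injective_projections => //; exact: group_power_square.
Qed.

Lemma card_C2n_Cm : (0 < m)%N -> #|G| = (2 ^ n * m)%N.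
Proof. by move=> m0; rewrite card_prod card_group_power card_ord prednK. Qed.

Lemma card_C2n_Cm_square_roots : (#|@square_roots G 1%g| <= 2 * 2 ^ n)%N.
Proof.
have -> : @square_roots G 1%g =
    finset.setX [set: group_power (cyclic_group 2) n]
      [set k : cyclic_group m | k * k == 1]%g%SET.
  apply/setP => x; rewrite !inE /= C2n_Cm_square.
  by apply/eqP/eqP => [/(congr1 snd)|->].
rewrite cardsX cardsT card_group_power mulnC leq_mul2r card_cyclic_square_roots orbT //.
Qed.

(** The family for the second moment: its elements, and products of two distinct ones, have
    nontrivial first component, whereas squares have a trivial one. *)
Definition C2n_nontrivial : {set G} :=
  [set ((f, 1%g) : G) | f in [set~ (1%g : group_power (cyclic_group 2) n)]]%SET.

Lemma card_C2n_nontrivial : #|C2n_nontrivial| = (2 ^ n - 1)%N.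
Proof.
rewrite card_imset; last by move=> f g [].
by rewrite cardsC1 card_group_power subn1.
Qed.

Lemma C2n_nontrivial_involution :
  {in C2n_nontrivial, forall x, x != 1 /\ x ^+ 2 = 1}%g.
Proof.
move=> _ /imsetP[f f1 ->]; rewrite C2n_Cm_square /= mulg1; split=> //.
by apply: contraTN f1 => /eqP/(congr1 fst) /= ->; rewrite !inE eqxx.
Qed.

Lemma C2n_nontrivial_nonsquare :
  {in C2n_nontrivial, forall x s, s ^+ 2 != x}%g.
Proof.
move=> _ /imsetP[f f1 ->] s; rewrite C2n_Cm_square.
by apply: contraTN f1 => /eqP/(congr1 fst) /= <-; rewrite !inE eqxx.
Qed.

Lemma C2n_nontrivial_sumfree :
  {in C2n_nontrivial &, forall x y, x != y -> forall s, s ^+ 2 != x * y}%g.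
Proof.
move=> _ _ /imsetP[f f1 ->] /imsetP[g g1 ->] fg s; rewrite C2n_Cm_square.
apply: contra fg => /eqP/(congr1 fst) /= fg1; apply/eqP; congr (_, _).
by apply: (mulIg g); rewrite -fg1 group_power_square.
Qed.

End C2nCm.

(** * Asymptotics of the group orders *)

Section Asymptotics.
Context {R : realType}.
Implicit Types (a x y p q A L N : R).
Local Open Scope classical_set_scope.
Import numFieldNormedType.Exports.

Lemma cvg_expR_linear a : 0 < a -> expR (- (a * n%:R)) @[n --> \oo] --> (0 : R).
Proof.
move=> a0.
have -> : (fun n : nat => expR (- (a * n%:R))) = (fun n => expR (- a) ^+ n).
  by apply/funext => n; rewrite -mulNr mulrC expRM_natl.
apply: cvg_expr; rewrite ger0_norm ?expR_ge0 // expR_lt1.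
by rewrite oppr_lt0.
Qed.

(** A small power of [N] absorbs the logarithm: [L <= 2 * expR (L / 2)] and
    [L <= 8 * expR (8^-1 * L)]. The constant [2 * A + 1] is chosen because its square dominates
    [2 * A]. *)
Lemma sqrt_log_bounds A L N p : 0 < A -> 0 <= p -> 0 <= L -> N = expR L ->
  p ^+ 2 <= A * (L / N) ->
  p <= (2 * A + 1) * expR (- (4^-1 * L)) /\
  N * p ^+ 3 <= 8 * A * (2 * A + 1) * expR (- (8^-1 * L)).
Proof.
move=> A0 p0 L0 NE p2.
have N0 : 0 < N by rewrite NE expR_gt0.
have pP : p <= (2 * A + 1) * expR (- (4^-1 * L)).
  rewrite -(@ler_pXn2r _ 2) // ?nnegrE ?mulr_ge0 ?expR_ge0 //; last by lra.
  apply: le_trans p2 _; rewrite exprMn -expRM_natl NE -expRN.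
  have -> : 2 * - (4^-1 * L) = - (L / 2) by field.
  have Lb : L <= 2 * expR (L / 2).
    by have := expR_ge1Dx (L / 2); lra.
  apply: (@le_trans _ _ (A * (2 * expR (L / 2) * expR (- L)))).
    by apply: ler_wpM2l; [exact: ltW|apply: ler_wpM2r Lb; exact: expR_ge0].
  rewrite -[2 * _ * _]mulrA -expRD (_ : L / 2 - L = - (L / 2)); last by field.
  rewrite mulrA; apply: ler_wpM2r; first exact: expR_ge0.
  by nra.
split=> //.
have Lb : L <= 8 * expR (8^-1 * L) by have := expR_ge1Dx (8^-1 * L); lra.
have -> : N * p ^+ 3 = (N * p ^+ 2) * p by ring.
have Np2 : N * p ^+ 2 <= A * L.
  rewrite mulrC -ler_pdivlMr //; apply: le_trans p2 _; rewrite mulrA //.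
apply: (@le_trans _ _ ((A * (8 * expR (8^-1 * L))) * ((2 * A + 1) * expR (- (4^-1 * L))))).
  apply: ler_pM => //; first by rewrite mulr_ge0 ?sqr_ge0 // ltW.
  by apply: le_trans Np2 _; rewrite ler_pM2l.
have -> : - (8^-1 * L) = 8^-1 * L + - (4^-1 * L) by field.
rewrite expRD le_eqVlt; apply/orP; left; apply/eqP.
by move: (expR (8^-1 * L)) (expR (- (4^-1 * L))) => u v; ring.
Qed.

(** The inverse of [1 - x] is [1 + x / (1 - x)], hence at most [expR (x / (1 - x))]. *)
Lemma one_subr_expR_ge x (n : nat) : 0 <= x < 1 ->
  expR (- (n%:R * x / (1 - x))) <= (1 - x) ^+ n.
Proof.
move=> /andP[x0 x1]; have x'0 : 0 < 1 - x by rewrite subr_gt0.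
rewrite -mulrA -mulrN expRM_natl; apply: lerXn2r; rewrite ?nnegrE ?expR_ge0 ?(ltW x'0) //.
rewrite expRN -[leRHS]invrK lef_pV2 ?posrE ?invr_gt0 ?expR_gt0 //.
apply: le_trans (expR_ge1Dx _).
by rewrite le_eqVlt; apply/orP; left; apply/eqP; field; rewrite gt_eqF.
Qed.

Section Order.
Variable c : R.
Hypothesis hc : 1 / 2 <= c < 1.
Local Notation m := (cyclic_factor_order c).
Local Notation L n := (ln (#|C2n_Cm c n|%:R : R)).

Let c0 : 0 < c. Proof. by move: hc; lra. Qed.
Let c1 : c < 1. Proof. by move: hc; lra. Qed.
Let ln2_gt0 : 0 < ln 2 :> R. Proof. by rewrite ln_gt0 // ltr1n. Qed.

Lemma cyclic_factor_order_gt0 n : (0 < m n)%N.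
Proof.
rewrite truncn_gt0 -[leLHS](powRr0 2); apply: ler_powR; first by rewrite ler1n.
by rewrite divr_ge0 ?mulr_ge0 ?subr_ge0 // ltW.
Qed.

Lemma card_C2n_CmR n : #|C2n_Cm c n|%:R = 2 ^+ n * (m n)%:R :> R.
Proof. by rewrite card_C2n_Cm ?cyclic_factor_order_gt0 // natrM natrX. Qed.

Lemma ln_card_C2n_Cm n : L n = n%:R * ln 2 + ln (m n)%:R.
Proof.
have m0 := cyclic_factor_order_gt0 n.
rewrite card_C2n_CmR lnM ?posrE ?exprn_gt0 ?ltr0n //.
by rewrite lnXn // mulr_natl.
Qed.

(** Rounding down a real number that is at least 1 loses at most a factor 2. *)
Lemma ln_cyclic_factor_order n :
  (1 - c) * n%:R / c * ln 2 - ln 2 <= ln (m n)%:R <= (1 - c) * n%:R / c * ln 2.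
Proof.
have m0 := cyclic_factor_order_gt0 n.
have mR0 : 0 < (m n)%:R :> R by rewrite ltr0n.
have /andP[le lt] := truncn_itv (powR_ge0 2 ((1 - c) * n%:R / c) : 0 <= 2 `^ _).
rewrite -ln_powR; apply/andP; split; last by rewrite ler_ln ?posrE ?powR_gt0.
rewrite lerBlDl -lnM ?posrE // ler_ln ?posrE ?powR_gt0 ?mulr_gt0 //.
apply: le_trans (ltW lt) _; rewrite -natrM ler_nat mul2n -addnn -addn1 leq_add2l //.
Qed.

(** Without rounding, [c * L n] would equal [n%:R * ln 2], since [1 + (1 - c) / c = 1 / c]; rounding
    down only lowers [L n]. *)
Lemma cln_card_le n : c * L n <= n%:R * ln 2.
Proof.
have /andP[_] := ln_cyclic_factor_order n; rewrite ln_card_C2n_Cm => h.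
rewrite mulrDr -lerBrDl; apply: le_trans (ler_wpM2l (ltW c0) h) _.
rewrite le_eqVlt; apply/orP; left; apply/eqP; field; exact: lt0r_neq0.
Qed.

Lemma cln_card_ge n : n%:R * ln 2 <= c * L n + ln 2.
Proof.
have /andP[h _] := ln_cyclic_factor_order n; rewrite ln_card_C2n_Cm.
have := ler_wpM2l (ltW c0) h.
have -> : c * ((1 - c) * n%:R / c * ln 2 - ln 2) = (1 - c) * n%:R * ln 2 - c * ln 2.
  by field; exact: lt0r_neq0.
have : c * ln 2 <= ln 2 by rewrite ger_pMl // ltW.
rewrite mulrDr; lra.
Qed.

Lemma ln_card_ge n : n%:R * ln 2 <= L n.
Proof.
rewrite ln_card_C2n_Cm lerDl ln_ge0 // ler1n; exact: cyclic_factor_order_gt0.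
Qed.

Lemma ln_card_ge0 n : 0 <= L n.
Proof. by apply: le_trans (ln_card_ge n); rewrite mulr_ge0 // ltW. Qed.

Lemma card_expR n : #|C2n_Cm c n|%:R = expR (L n).
Proof.
rewrite lnK // posrE card_C2n_CmR mulr_gt0 ?exprn_gt0 // ltr0n.
exact: cyclic_factor_order_gt0.
Qed.

Lemma expn2_expR n : 2 ^+ n = expR (n%:R * ln 2) :> R.
Proof. by rewrite expRM_natl lnK // posrE. Qed.

Lemma cvg_expR_ln_card a : 0 < a -> expR (- (a * L n)) @[n --> \oo] --> (0 : R).
Proof.
move=> a0; apply: (@squeeze_cvgr _ _ _ _ (fun=> 0) (fun n : nat => expR (- (a * ln 2 * n%:R)))).
- near=> n; rewrite expR_ge0 /= ler_expR lerN2 -mulrA ler_pM2l // mulrC.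
  exact: ln_card_ge.
- exact: cvg_cst.
- by apply: cvg_expR_linear; rewrite mulr_gt0.
Unshelve. all: by end_near. Qed.

(** As [c < 1], the cyclic factor grows exponentially. The square roots of [1], at most [2 * 2 ^ n]
    in number, thus become a vanishing proportion of the group. *)
Lemma cvg_inv_cyclic_factor_order : ((m n)%:R^-1 : R) @[n --> \oo] --> (0 : R).
Proof.
pose a : R := (1 - c) / c * ln 2.
have a0 : 0 < a by rewrite mulr_gt0 // divr_gt0 // subr_gt0.
apply: (@squeeze_cvgr _ _ _ _ (fun=> 0) (fun n : nat => 2 * expR (- (a * n%:R)))).
- near=> n; rewrite invr_ge0 ler0n /=.
  have mR0 : 0 < (m n)%:R :> R by rewrite ltr0n cyclic_factor_order_gt0.
  rewrite -[leLHS]lnK ?posrE ?invr_gt0 // lnV ?posrE //.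
  rewrite -[X in X * _](@lnK _ 2) ?posrE // -expRD ler_expR.
  have /andP[+ _] := ln_cyclic_factor_order n.
  have -> : (1 - c) * n%:R / c * ln 2 = a * n%:R by rewrite /a; ring.
  lra.
- exact: cvg_cst.
- by rewrite -[X in _ --> X](mulr0 2); apply: cvgMr; exact: cvg_expR_linear.
Unshelve. all: by end_near. Qed.

End Order.
End Asymptotics.

(** * Explicit probability estimates for a fixed [n] *)

Section Threshold.
Context {R : realType}.
Local Open Scope classical_set_scope.
Import numFieldNormedType.Exports.
Variable c : R.
Hypothesis hc : 1 / 2 <= c < 1.
Local Notation G n := (C2n_Cm c n).
Local Notation m n := (cyclic_factor_order c n).
Local Notation L n := (ln (#|C2n_Cm c n|%:R : R)).

(** The involutions contribute about [2 ^ n * expR (- ((c + d) * L n))] and the other elements about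
    [expR (L n - 2 * (c + d) * L n)]. The factor [1 - 10 / m] absorbs the exceptional vertices in
    both edge counts. *)
Lemma diameter_gt2_estimate (n : nat) (A d p q : R) :
  0 <= q -> q <= p -> p <= 1 -> 8 * q <= 1 -> 10 / (m n)%:R <= 1 :> R ->
  0 <= d -> q ^+ 2 = A * (L n / #|G n|%:R) ->
  c + d <= A * (1 - 8 * q) * (1 - 10 / (m n)%:R) ->
  cayley_prob p (fun e : rel (G n) => (2%:E < diameter R e)%E) <=
    5 * expR (- (d * L n)).
Proof.
move=> q0 qp p1 q8 m10 d0 q2 cd.
apply: le_trans (cayley_prob_diameter_gt2_le (@C2n_CmC R c n) q0 qp p1 q8) _.
set a := 1 - q ^+ 2 + 8 * q ^+ 3.
set tau := #|square_roots 1%g|; set N := #|G n|.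
have L0 := ln_card_ge0 hc n.
have mR0 : 0 < (m n)%:R :> R by rewrite ltr0n cyclic_factor_order_gt0.
have NR0 : 0 < N%:R :> R by rewrite /N card_expR // expR_gt0.
have a0 : 0 <= a by rewrite /a; nra.
have tau_le : tau%:R <= 2 * 2 ^+ n :> R.
  by rewrite -natrX -natrM ler_nat card_C2n_Cm_square_roots.
have NmE : N%:R = 2 ^+ n * (m n)%:R :> R by exact: card_C2n_CmR.
(* [x] will be 1 for the involutions and 2 for the other elements. *)
have apow K x : 0 <= x -> N%:R * (1 - 10 / (m n)%:R) * x <= K%:R ->
    a ^+ K <= expR (- ((c + d) * L n * x)).
  move=> x0 hK.
  apply: (@le_trans _ _ (expR (- (q ^+ 2 * (1 - 8 * q))) ^+ K)).
    apply: lerXn2r; rewrite ?nnegrE ?expR_ge0 //.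
    apply: le_trans (expR_ge1Dx _); rewrite /a le_eqVlt; apply/orP; left; apply/eqP; ring.
  rewrite -expRM_natl ler_expR mulrN lerN2.
  have h0 : 0 <= q ^+ 2 * (1 - 8 * q) by rewrite mulr_ge0 ?sqr_ge0 // subr_ge0.
  apply: le_trans (ler_wpM2r h0 hK).
  have -> : N%:R * (1 - 10 / (m n)%:R) * x * (q ^+ 2 * (1 - 8 * q)) =
      A * (1 - 8 * q) * (1 - 10 / (m n)%:R) * L n * x.
    by rewrite q2 -/N; field; rewrite !gt_eqF.
  by apply: ler_wpM2r => //; apply: ler_wpM2r.
have subR (i j : nat) : i%:R - j%:R <= (i - j)%:R :> R.
  by rewrite lerBlDr -natrD ler_nat addnC -leq_subLR.
have pow2E : 2 ^+ n = N%:R / (m n)%:R :> R by rewrite NmE mulfK // gt_eqF.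
have K1 : a ^+ (N - 2 * tau) <= expR (- ((c + d) * L n * 1)).
  apply: apow => //; apply: le_trans (subR _ _); rewrite natrM mulr1.
  have -> : N%:R * (1 - 10 / (m n)%:R) = N%:R - 10 * 2 ^+ n :> R by rewrite pow2E; ring.
  have : 0 <= 2 ^+ n :> R by rewrite exprn_ge0.
  by move: tau_le; move: (2 ^+ n) => z; lra.
have K2 : a ^+ (2 * N - 10 * tau) <= expR (- ((c + d) * L n * 2)).
  apply: apow => //; apply: le_trans (subR _ _); rewrite (natrM _ 2 N) (natrM _ 10 tau).
  have -> : N%:R * (1 - 10 / (m n)%:R) * 2 = 2 * N%:R - 20 * 2 ^+ n :> R by rewrite pow2E; ring.
  by move: tau_le; move: (2 ^+ n) (tau%:R) (N%:R) => z t N'; clear; lra.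
have T1 : tau%:R * a ^+ (N - 2 * tau) <= 4 * expR (- (d * L n)).
  apply: (@le_trans _ _ ((2 * 2 ^+ n) * expR (- ((c + d) * L n * 1)))).
    by apply: ler_pM => //; exact: exprn_ge0.
  rewrite expn2_expR -mulrA -expRD.
  have -> : 4 * expR (- (d * L n)) = 2 * (expR (ln 2) * expR (- (d * L n))).
    by rewrite lnK ?posrE // mulrA -natrM.
  rewrite ler_pM2l // -expRD ler_expR; have := cln_card_ge hc n; clear; lra.
have T2 : N%:R * a ^+ (2 * N - 10 * tau) <= expR (- (d * L n)).
  apply: (@le_trans _ _ (N%:R * expR (- ((c + d) * L n * 2)))); first by rewrite ler_pM2l.
  rewrite [X in X * _](card_expR hc n : N%:R = _) -expRD ler_expR.
  (* Here [c >= 1 / 2] enters: it makes the contribution of the elements that are not involutions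
     negligible. *)
  have : 0 <= (2 * c - 1) * L n by rewrite mulr_ge0 //; case/andP: hc => h _; clear - h; lra.
  by have : 0 <= d * L n; [rewrite mulr_ge0|clear; lra].
by move: (lerD T1 T2) => /le_trans; apply; clear; lra.
Qed.

(** The family has at least [expR (c * L n) / 2] elements, [1 - p] is at least [1 / 2] and the
    remaining power at least [expR (- ((c - d) * L n))], so the expected number of uncovered
    elements is at least [expR (d * L n) / 4]. *)
Lemma diameter_le2_estimate (n : nat) (A d p : R) : (0 < n)%N -> 0 <= p <= 1 / 2 ->
  p ^+ 2 <= A * (L n / #|G n|%:R) -> A / (1 - p ^+ 2) <= c - d ->
  cayley_prob p (fun e : rel (G n) => (diameter R e <= 2%:E)%E) <=
    4 * expR (- (d * L n)) + (expR (64 * (#|G n|%:R * p ^+ 3)) / (1 - p) ^+ 2 - 1).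
Proof.
move=> n0 /andP[p0 p12] p2 Ad.
have p1 : p < 1 by lra.
have L0 := ln_card_ge0 hc n.
have pow2n : (2 <= 2 ^ n)%N by rewrite -{1}(expn1 2) leq_exp2l.
apply: le_trans (cayley_prob_diameter_le2_le (@C2n_CmC R c n) p0 p1
  (@C2n_nontrivial_involution R c n) (@C2n_nontrivial_nonsquare R c n)
  (@C2n_nontrivial_sumfree R c n) _) _.
  by rewrite card_C2n_nontrivial subn_gt0.
set N := #|G n|.
have NR0 : 0 < N%:R :> R by rewrite /N card_expR // expR_gt0.
have p'0 : 0 < 1 - p by rewrite subr_gt0.
have b34 : 3 / 4 <= 1 - p ^+ 2 by nra.
have p3 : 0 <= p ^+ 3 by rewrite exprn_ge0.
have b0 : 0 < 1 - p ^+ 2 by lra.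
apply: lerD; last first.
  rewrite lerD2r; apply: ler_wpM2r; first by rewrite invr_ge0 exprn_ge0 // ltW.
  have -> : 64 * (N%:R * p ^+ 3) = (2 * N)%:R * (32 * p ^+ 3) by rewrite natrM; ring.
  rewrite expRM_natl; apply: lerXn2r; rewrite ?nnegrE ?expR_ge0 //.
    by rewrite divr_ge0 // ?ltW //; lra.
  (* Since [1 - p ^+ 2] is at least [1 / 2], the ratio is at most [1 + 32 * p ^+ 3]. *)
  apply: le_trans (expR_ge1Dx _); rewrite ler_pdivrMr //; nra.
rewrite -[4 * _]invrK lef_pV2 ?posrE ?invr_gt0 ?mulr_gt0 ?expR_gt0 ?exprn_gt0 //; last first.
  by rewrite ltr0n card_C2n_nontrivial subn_gt0.
have Vge : 2^-1 * expR (c * L n) <= #|C2n_nontrivial c n|%:R.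
  apply: (@le_trans _ _ (2^-1 * 2 ^+ n)).
    by rewrite ler_pM2l ?invr_gt0 // expn2_expR ler_expR cln_card_le.
  rewrite card_C2n_nontrivial -natrX mulrC ler_pdivrMr // -natrM ler_nat.
  by rewrite mulnBl mul1n muln2 -addnn -addnBA // leq_addr.
have powge : expR (- ((c - d) * L n)) <= (1 - p ^+ 2) ^+ N.
  apply: le_trans (one_subr_expR_ge N _); last by rewrite sqr_ge0; lra.
  rewrite ler_expR lerN2; apply: (@le_trans _ _ (A / (1 - p ^+ 2) * L n)).
    rewrite [leRHS]mulrAC; apply: ler_wpM2r; first by rewrite invr_ge0 ltW.
    by rewrite mulrC -ler_pdivlMr // -mulrA.
  exact: ler_wpM2r.
rewrite invfM -expRN opprK.
apply: (@le_trans _ _ ((2^-1 * expR (c * L n)) * (2^-1 * expR (- ((c - d) * L n))))).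
  rewrite le_eqVlt; apply/orP; left; apply/eqP.
  have -> : d * L n = c * L n + - ((c - d) * L n) by ring.
  by rewrite expRD; move: (expR _) (expR _) => u v; field.
apply: ler_pM => //; rewrite ?mulr_ge0 ?invr_ge0 ?expR_ge0 //.
by apply: ler_pM => //; rewrite ?invr_ge0 ?expR_ge0 //; clear - p12; lra.
Qed.

End Threshold.

(** * Passage to the limit on each side of the threshold *)

Section Limits.
Context {R : realType}.
Local Open Scope classical_set_scope.
Import numFieldNormedType.Exports.
Variable c : R.
Hypothesis hc : 1 / 2 <= c < 1.
Local Notation G n := (C2n_Cm c n).
Local Notation m n := (cyclic_factor_order c n).
Local Notation L n := (ln (#|C2n_Cm c n|%:R : R)).

Lemma cvg_sqrt_log (A : R) (p : nat -> R) : 0 < A -> (forall n, 0 <= p n) ->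
  (\forall n \near \oo, p n ^+ 2 <= A * (L n / #|G n|%:R)) ->
  p n @[n --> \oo] --> (0 : R) /\ #|G n|%:R * p n ^+ 3 @[n --> \oo] --> (0 : R).
Proof.
move=> A0 p0 p2.
have bnd : \forall n \near \oo,
    p n <= (2 * A + 1) * expR (- (4^-1 * L n)) /\
    #|G n|%:R * p n ^+ 3 <= 8 * A * (2 * A + 1) * expR (- (8^-1 * L n)).
  apply: filterS p2 => n; apply: sqrt_log_bounds => //; first exact: ln_card_ge0.
  exact: card_expR.
have lim0 (C a : R) : 0 < a -> C * expR (- (a * L n)) @[n --> \oo] --> (0 : R).
  move=> a0; rewrite -[X in _ --> X](mulr0 C); apply: cvgMr; exact: cvg_expR_ln_card.
split.
  apply: (@squeeze_cvgr _ _ _ _ (fun=> 0) (fun n => (2 * A + 1) * expR (- (4^-1 * L n)))).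
  - by apply: filterS bnd => n [h _]; rewrite p0.
  - exact: cvg_cst.
  - by apply: lim0; rewrite invr_gt0.
apply: (@squeeze_cvgr _ _ _ _ (fun=> 0)
  (fun n => 8 * A * (2 * A + 1) * expR (- (8^-1 * L n)))).
- by apply: filterS bnd => n [_ h]; rewrite h mulr_ge0 // exprn_ge0.
- exact: cvg_cst.
- by apply: lim0; rewrite invr_gt0.
Qed.

Lemma cvg_cayley_prob_diameter_le2 (eps : R) (p : nat -> R) :
  0 < eps -> (forall k, 0 <= p k <= 1) ->
  (\forall k \near \oo,
     Num.sqrt ((c + eps) * (L k / #|G k|%:R)) <= p k) ->
  cayley_prob (p k) (fun e : rel (G k) => (diameter R e <= 2%:E)%E)
    @[k --> \oo] --> (1 : R).
Proof.
move=> eps0 p01 hp.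
have c0 : 0 < c by case/andP: hc => h _; clear - h; lra.
(* [q] is the smallest admissible value of [p]: it tends to 0, as the estimate requires, whereas [p]
   may stay large. *)
pose A := c + eps; pose q n : R := Num.sqrt (A * (L n / #|G n|%:R)).
have A0 : 0 < A by rewrite addr_gt0.
have q0 n : 0 <= q n by exact: sqrtr_ge0.
have q2 n : q n ^+ 2 = A * (L n / #|G n|%:R).
  rewrite sqr_sqrtr // mulr_ge0 ?(ltW A0) // divr_ge0 // ln_card_ge0 //.
have [q_cvg _] : q n @[n --> \oo] --> (0 : R) /\ #|G n|%:R * q n ^+ 3 @[n --> \oo] --> (0 : R).
  by apply: (@cvg_sqrt_log A) => //; near=> n; rewrite q2.
pose f n : R := A * (1 - 8 * q n) * (1 - 10 * (m n)%:R^-1).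
have m_cvg := cvg_inv_cyclic_factor_order hc.
have f_cvg : f n @[n --> \oo] --> A.
  have -> : A = A * (1 - 8 * 0) * (1 - 10 * 0) by rewrite !mulr0 subr0 !mulr1.
  apply: cvgM; [apply: cvgMr|]; apply: cvgB; try exact: cvg_cst; apply: cvgMr => //.
have gt2_cvg : cayley_prob (p k) (fun e : rel (G k) => (2%:E < diameter R e)%E)
    @[k --> \oo] --> (0 : R).
  apply: (@squeeze_cvgr _ _ _ _ (fun=> 0) (fun n => 5 * expR (- (eps / 2 * L n)))).
  - near=> n; rewrite cayley_prob_ge0 //=.
    have /andP[_ p1] := p01 n.
    apply: (@diameter_gt2_estimate R c hc n A (eps / 2) (p n) (q n)) => //.
    + by near: n.
    + rewrite mulrC -ler_pdivlMr // div1r ltW //; near: n.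
      by apply: cvgr_lt q_cvg _ _; rewrite invr_gt0.
    + rewrite mulrC -ler_pdivlMr // div1r ltW //; near: n.
      by apply: cvgr_lt m_cvg _ _; rewrite invr_gt0.
    + by rewrite divr_ge0 // ltW.
    (* The limit [c + eps] of [f] leaves room above [c + eps / 2]. *)
    + apply: ltW; near: n; apply: cvgr_gt f_cvg _ _.
      by rewrite /A ltrD2l gtr_pMr // invf_lt1 // ltr1n.
  - exact: cvg_cst.
  - rewrite -[X in _ --> X](mulr0 5); apply: cvgMr; apply: cvg_expR_ln_card => //.
    by rewrite divr_gt0.
rewrite (_ : (fun k => _) = (fun k =>
    1 - cayley_prob (p k) (fun e : rel (G k) => (2%:E < diameter R e)%E))); last first.
  by apply/funext => k; exact: cayley_prob_diameter_le2E.
by rewrite -[X in _ --> X](subr0 1); apply: cvgB => //; exact: cvg_cst.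
Unshelve. all: by end_near. Qed.

(** The upper bound on [p] makes both [p] and [#|G n|%:R * p ^+ 3] tend to 0, which removes the
    correlation error in [diameter_le2_estimate]. *)
Lemma cvg_cayley_prob_diameter_gt2 (eps : R) (p : nat -> R) :
  0 < eps < c -> (forall k, 0 <= p k <= 1) ->
  (\forall k \near \oo,
     p k <= Num.sqrt ((c - eps) * (L k / #|G k|%:R))) ->
  cayley_prob (p k) (fun e : rel (G k) => (2%:E < diameter R e)%E)
    @[k --> \oo] --> (1 : R).
Proof.
move=> /andP[eps0 epsc] p01 hp.
pose A := c - eps.
have A0 : 0 < A by rewrite subr_gt0.
have p0 n : 0 <= p n by case/andP: (p01 n).
have p2 : \forall n \near \oo, p n ^+ 2 <= A * (L n / #|G n|%:R).
  apply: filterS hp => n pn; have AL0 : 0 <= A * (L n / #|G n|%:R).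
    by rewrite mulr_ge0 ?(ltW A0) // divr_ge0 // ln_card_ge0.
  by rewrite -(sqr_sqrtr AL0) lerXn2r // nnegrE // sqrtr_ge0.
have [p_cvg Np3_cvg] := cvg_sqrt_log A0 p0 p2.
have p1_cvg : 1 - p n @[n --> \oo] --> (1 : R).
  by rewrite -[X in _ --> X](subr0 1); apply: cvgB => //; exact: cvg_cst.
have f_cvg : A / (1 - p n ^+ 2) @[n --> \oo] --> A.
  rewrite -[X in _ --> X]mulr1 -{2}invr1; apply: cvgMr; apply: cvgV; first exact: oner_neq0.
  rewrite -[X in _ --> X](subr0 1); apply: cvgB; first exact: cvg_cst.
  by rewrite -(mulr0 0); apply: cvgM.
have le2_cvg : cayley_prob (p k) (fun e : rel (G k) => (diameter R e <= 2%:E)%E)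
    @[k --> \oo] --> (0 : R).
  apply: (@squeeze_cvgr _ _ _ _ (fun=> 0) (fun n => 4 * expR (- (eps / 2 * L n)) +
     (expR (64 * (#|G n|%:R * p n ^+ 3)) / (1 - p n) ^+ 2 - 1))).
  - near=> n; rewrite cayley_prob_ge0 //=.
    apply: (@diameter_le2_estimate R c hc n A).
    + by near: n; exact: nbhs_infty_gt.
    + rewrite p0 /= ltW //; near: n.
      by apply: cvgr_lt p_cvg _ _; rewrite divr_gt0.
    + by near: n.
    + apply: ltW; near: n; apply: cvgr_lt f_cvg _ _.
      by rewrite /A ltrD2l ltrN2 gtr_pMr // invf_lt1 // ltr1n.
  - exact: cvg_cst.
  - have -> : 0 = 4 * 0 + (expR (64 * 0) / (1 * 1) - 1) :> R.
      by rewrite !mulr0 expR0 mulr1 invr1 mulr1 subrr addr0.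
    apply: cvgD.
      apply: cvgMr; apply: cvg_expR_ln_card => //; by rewrite divr_gt0.
    apply: cvgB; last exact: cvg_cst.
    apply: cvgM.
      apply: continuous_cvg; first exact: continuous_expR.
      exact: cvgMr.
    by apply: cvgV; [rewrite mulr1 oner_neq0|apply: cvgM].
rewrite (_ : (fun k => _) = (fun k =>
    1 - cayley_prob (p k) (fun e : rel (G k) => (diameter R e <= 2%:E)%E))); last first.
  by apply/funext => k; rewrite cayley_prob_diameter_le2E opprB addrC subrK.
by rewrite -[X in _ --> X](subr0 1); apply: cvgB => //; exact: cvg_cst.
Unshelve. all: by end_near. Qed.

End Limits.

Theorem theorem1p3 (R : realType) (c : R) (hc : 1 / 2 <= c < 1) :
  diameter2_threshold (fun n : nat => C2n_Cm c n) c.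
Proof.
have c0 : 0 < c by case/andP: hc => h _; clear - h; lra.
split=> // eps eps0 p p01; split; last exact: cvg_cayley_prob_diameter_le2.
(* [eps] may be [c] or more, where [c - eps] is not positive. Replacing it by a smaller [eps'] only
   raises the upper bound on [p]. *)
move=> hp; pose eps' := Num.min eps (c / 2).
apply: (@cvg_cayley_prob_diameter_gt2 _ _ hc eps') => //.
  rewrite lt_min eps0 divr_gt0 //= gt_min; apply/orP; right.
  by rewrite gtr_pMr // invf_lt1 // ltr1n.
apply: filterS hp => n /le_trans; apply; apply: ler_wsqrtr.
apply: ler_wpM2r; first by rewrite divr_ge0 // ln_card_ge0.
by rewrite lerD2l lerN2 ge_min lexx.
Qed.
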